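(* For $n\ge0$ let $c_n$ (respectively $d_n$) be the number of nonnesting permutations of the multiset $\{1,1,\dots,n,n\}$ avoiding $123$ (respectively $321$), and let $C(z)=\sum_{n\ge0}c_nz^n$. Then $d_n=c_n$ for every $n\ge 0$. Consequently, $\sum_{n\ge0}d_nz^n=C(z)$, this generating function has algebraic degree exactly $4$ over $\mathbb{Q}(z)$, and, as $n\to\infty$, \[ d_n\sim\frac{9+6\sqrt3}{8\sqrt{\pi}}\,6^n\,n^{-3/2}. \]
   Context: For $n\ge 0$, a nonnesting permutation of $\{1,1,2,2,\dots,n,n\}$ is a word $w=w_1w_2\cdots w_{2n}$ using each of the labels $1,\dots,n$ exactly twice such that there are no indices $i<j<k<\ell$ and labels $a\ne b$ with $w_i=w_\ell=a$ and $w_j=w_k=b$. The word $w$ avoids $123$ if there are no indices $i<j<k$ with $w_i<w_j<w_k$, and avoids $321$ if there are no indices $i<j<k$ with $w_i>w_j>w_k$. The empty word is the unique word for $n=0$, so $c_0=d_0=1$. *)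

(* Defs.v *)
From HB Require Import structures.
From mathcomp Require Import all_boot all_order all_algebra.
From mathcomp Require Import generic_quotient fraction.
From mathcomp Require Import boolp.

Set Implicit Arguments.
Unset Strict Implicit.
Unset Printing Implicit Defensive.

Import Order.TTheory GRing.Theory Num.Theory.

(* Words of length 2n on n labels; the label a in {1, ..., n} is encoded as
   a - 1 : 'I_n, which preserves the order of the labels. *)
Section Words.
Variable n : nat.
Implicit Type w : (2 * n).-tuple 'I_n.

Definition each_label_twice w := [forall a : 'I_n, count_mem a w == 2].

Definition nonnesting w :=
  ~~ [exists i : 'I_(2 * n), exists j : 'I_(2 * n),
      exists k : 'I_(2 * n), exists l : 'I_(2 * n),
        [&& i < j, j < k, k < l, tnth w i == tnth w l,
            tnth w j == tnth w k & tnth w i != tnth w j]].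

Definition avoids123 w :=
  ~~ [exists i : 'I_(2 * n), exists j : 'I_(2 * n), exists k : 'I_(2 * n),
        [&& i < j, j < k, tnth w i < tnth w j & tnth w j < tnth w k]].

Definition avoids321 w :=
  ~~ [exists i : 'I_(2 * n), exists j : 'I_(2 * n), exists k : 'I_(2 * n),
        [&& i < j, j < k, tnth w i > tnth w j & tnth w j > tnth w k]].

End Words.

Definition c_ (n : nat) : nat :=
  #|[set w : (2 * n).-tuple 'I_n |
      [&& each_label_twice w, nonnesting w & avoids123 w]]|.

Definition d_ (n : nat) : nat :=
  #|[set w : (2 * n).-tuple 'I_n |
      [&& each_label_twice w, nonnesting w & avoids321 w]]|.

Local Open Scope ring_scope.

Record fps (K : fieldType) := FPS { fcoef : nat -> K }.

Section FormalPowerSeries.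
Variable K : fieldType.
Implicit Types f g h : fps K.

HB.instance Definition _ := gen_eqMixin (fps K).
HB.instance Definition _ := gen_choiceMixin (fps K).

Lemma fpsP f g : fcoef f =1 fcoef g -> f = g.
Proof. by case: f g => [f] [g] /= /funext ->. Qed.

Definition fps_zero : fps K := FPS (fun _ => 0).
Definition fps_one : fps K := FPS (fun n => (n == 0)%:R).
Definition fps_opp f : fps K := FPS (fun n => - fcoef f n).
Definition fps_add f g : fps K := FPS (fun n => fcoef f n + fcoef g n).
Definition fps_mul f g : fps K :=
  FPS (fun n => \sum_(i < n.+1) fcoef f i * fcoef g (n - i)).

Fact fps_addA : associative fps_add.
Proof. by move=> f g h; apply: fpsP => n /=; rewrite addrA. Qed.

Fact fps_addC : commutative fps_add.
Proof. by move=> f g; apply: fpsP => n /=; rewrite addrC. Qed.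

Fact fps_add0 : left_id fps_zero fps_add.
Proof. by move=> f; apply: fpsP => n /=; rewrite add0r. Qed.

Fact fps_addN : left_inverse fps_zero fps_opp fps_add.
Proof. by move=> f; apply: fpsP => n /=; rewrite addNr. Qed.

HB.instance Definition _ :=
  GRing.isZmodule.Build (fps K) fps_addA fps_addC fps_add0 fps_addN.

Definition fps_trunc (n : nat) f : {poly K} := \poly_(i < n.+1) fcoef f i.

Lemma coef_fps_trunc n f i : (i <= n)%N -> (fps_trunc n f)`_i = fcoef f i.
Proof. by move=> le_in; rewrite coef_poly ltnS le_in. Qed.

Lemma fcoef_mul_trunc n f g i : (i <= n)%N ->
  fcoef (fps_mul f g) i = (fps_trunc n f * fps_trunc n g)`_i.
Proof.
move=> le_in; rewrite coefM /=; apply: eq_bigr => j _.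
by rewrite !coef_fps_trunc ?(leq_trans (leq_subr _ _)) // (leq_trans _ le_in) // -ltnS.
Qed.

Fact fps_mulC : commutative fps_mul.
Proof.
by move=> f g; apply: fpsP => n; rewrite !(@fcoef_mul_trunc n) // mulrC.
Qed.

Lemma fcoef_mul_truncl (n : nat) f g (p : {poly K}) :
  (forall i, (i <= n)%N -> fcoef f i = p`_i) ->
  fcoef (fps_mul f g) n = (p * fps_trunc n g)`_n.
Proof.
move=> fp; rewrite coefM /=; apply: eq_bigr => j _.
by rewrite fp 1?coef_fps_trunc ?leq_subr // -ltnS.
Qed.

Fact fps_mulA : associative fps_mul.
Proof.
move=> f g h; apply: fpsP => n; rewrite fps_mulC.
rewrite (@fcoef_mul_truncl n _ _ (fps_trunc n g * fps_trunc n h)); last first.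
  by move=> i; exact: fcoef_mul_trunc.
rewrite (@fcoef_mul_truncl n _ _ (fps_trunc n f * fps_trunc n g)); last first.
  by move=> i; exact: fcoef_mul_trunc.
by rewrite mulrC mulrA.
Qed.

Fact fps_mul1 : left_id fps_one fps_mul.
Proof.
move=> f; apply: fpsP => n /=; rewrite big_ord_recl /= mul1r subn0.
by rewrite big1 ?addr0 // => i _; rewrite mul0r.
Qed.

Fact fps_mulD : left_distributive fps_mul fps_add.
Proof.
move=> f g h; apply: fpsP => n /=; rewrite -big_split /=.
by apply: eq_bigr => i _; rewrite mulrDl.
Qed.

Fact fps_one_neq0 : fps_one != 0.
Proof.
by apply/eqP => /(congr1 (fun f => fcoef f 0)) /= /eqP; rewrite oner_eq0.
Qed.

HB.instance Definition _ := GRing.Zmodule_isComNzRing.Build (fps K)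
  fps_mulA fps_mulC fps_mul1 fps_mulD fps_one_neq0.

Definition fps_unit : {pred fps K} := fun f => `[< exists g, g * f = 1 >].
Definition fps_inv f : fps K :=
  if pselect (exists g, g * f = 1) is left ex_g then projT1 (cid ex_g) else f.

Fact fps_mulV : {in fps_unit, left_inverse 1 fps_inv *%R}.
Proof.
move=> f /asboolP ex_g; rewrite /fps_inv.
by case: pselect => // ex_g'; case: cid.
Qed.

Fact fps_unitPl f g : g * f = 1 -> fps_unit f.
Proof. by move=> gf1; apply/asboolP; exists g. Qed.

Fact fps_inv_out : {in [predC fps_unit], fps_inv =1 id}.
Proof.
by move=> f /asboolP not_ex_g; rewrite /fps_inv; case: pselect.
Qed.

HB.instance Definition _ := GRing.ComNzRing_hasMulInverse.Build (fps K)
  fps_mulV fps_unitPl fps_inv_out.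

Lemma fps_neq0_order f : f != 0 ->
  exists2 m, fcoef f m != 0 & forall i, (i < m)%N -> fcoef f i = 0.
Proof.
move=> f_neq0; have ex_m : exists m, fcoef f m != 0.
  apply: contrapT => not_ex; case/eqP: f_neq0; apply: fpsP => n.
  by apply: contrapT => /eqP fn; apply: not_ex; exists n.
case: (ex_minnP ex_m) => m fm m_min; exists m => // i lt_im.
by apply/eqP; apply: contraTT lt_im => /m_min; rewrite -leqNgt.
Qed.

Fact fps_integral f g : f * g = 0 -> (f == 0) || (g == 0).
Proof.
move=> fg0; apply: contraT; rewrite negb_or => /andP[].
move=> /fps_neq0_order[a fa a_min] /fps_neq0_order[b gb b_min].
have: fcoef (f * g) (a + b) = 0 by rewrite fg0.
rewrite /= (bigD1 (inord a : 'I_(a + b).+1)) //= inordK ?ltnS ?leq_addr //.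
rewrite addKn big1 ?addr0 => [/eqP | i i_neq_a].
  by rewrite mulf_eq0 (negPf fa) (negPf gb).
case: (ltngtP i a) => [lt_ia | lt_ai | eq_ia].
- by rewrite a_min ?mul0r.
- have le_i : (i <= a + b)%N by rewrite -ltnS.
  by rewrite b_min ?mulr0 // ltn_subLR // ltn_add2r.
by case/eqP: i_neq_a; apply: val_inj; rewrite /= inordK ?ltnS ?leq_addr.
Qed.

HB.instance Definition _ :=
  GRing.ComUnitRing_isIntegral.Build (fps K) fps_integral.

Definition fps_of_poly (p : {poly K}) : fps K := FPS (fun n => p`_n).

Fact fps_of_poly_zmod_morphism : zmod_morphism fps_of_poly.
Proof. by move=> p q; apply: fpsP => n; rewrite /= coefB. Qed.

Fact fps_of_poly_monoid_morphism : monoid_morphism fps_of_poly.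
Proof.
by split=> [|p q]; apply: fpsP => n; rewrite /= ?coef1 ?coefM.
Qed.

HB.instance Definition _ := GRing.isZmodMorphism.Build {poly K} (fps K)
  fps_of_poly fps_of_poly_zmod_morphism.
HB.instance Definition _ := GRing.isMonoidMorphism.Build {poly K} (fps K)
  fps_of_poly fps_of_poly_monoid_morphism.

Lemma fps_of_poly_inj : injective fps_of_poly.
Proof.
by move=> p q /(congr1 (@fcoef K)) eq_pq; apply/polyP => n; exact: (congr1 (@^~ n) eq_pq).
Qed.

End FormalPowerSeries.

Notation "x %:F" := (@FracField.tofrac _ x) : ring_scope.

(* The field K((z)) of formal Laurent series is {fraction (fps K)}; it contains
   the field K(z) of rational functions, {fraction {poly K}}. *)
Section RationalFunctions.
Variable K : fieldType.
Local Notation ratfun := {fraction {poly K}}.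
Local Notation laurent := {fraction (fps K)}.

Definition laurent_of_ratfun (x : ratfun) : laurent :=
  (fps_of_poly \n_(repr x))%:F / (fps_of_poly \d_(repr x))%:F.

Lemma fps_of_poly_fracr_eq0 (p : {poly K}) :
  ((fps_of_poly p)%:F == 0 :> laurent) = (p == 0).
Proof. by rewrite tofrac_eq0 -(inj_eq (@fps_of_poly_inj K)) rmorph0. Qed.

Lemma ratfun_numden (x : ratfun) : x = (\n_(repr x))%:F / (\d_(repr x))%:F.
Proof.
have d_neq0 : (\d_(repr x))%:F != 0 :> ratfun by rewrite tofrac_eq0 denom_ratioP.
apply: (mulIf d_neq0); rewrite divfK //; rewrite -{1}[x]reprK.
rewrite /FracField.tofrac; unlock.
rewrite -[LHS]FracField.pi_mul; apply/eqP; rewrite FracField.equivf_def.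
rewrite /FracField.mulf !numden_Ratio ?mulr1 ?oner_neq0 ?denom_ratioP //.
by rewrite mulrC.
Qed.

Lemma laurent_of_ratfunE (p q : {poly K}) : q != 0 ->
  laurent_of_ratfun (p%:F / q%:F) = (fps_of_poly p)%:F / (fps_of_poly q)%:F.
Proof.
move=> q_neq0; rewrite /laurent_of_ratfun.
set x := p%:F / q%:F; have := ratfun_numden x; rewrite {1}/x.
have d_neq0 : \d_(repr x) != 0 by exact: denom_ratioP.
move/eqP; rewrite eqr_div ?tofrac_eq0 // -!rmorphM tofrac_eq => /eqP pq.
apply/eqP; rewrite eqr_div ?fps_of_poly_fracr_eq0 //.
by rewrite -!rmorphM tofrac_eq -pq.
Qed.

Fact laurent_of_ratfun_zmod_morphism : zmod_morphism laurent_of_ratfun.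
Proof.
have subE (p q r s : {poly K}) : q != 0 -> s != 0 ->
    laurent_of_ratfun (p%:F / q%:F - r%:F / s%:F) =
    (fps_of_poly p)%:F / (fps_of_poly q)%:F
      - (fps_of_poly r)%:F / (fps_of_poly s)%:F.
  move=> q0 s0; rewrite -!mulNr !addf_div ?(fps_of_poly_fracr_eq0, tofrac_eq0) //.
  by rewrite -!rmorphN -!rmorphM -!rmorphD laurent_of_ratfunE ?mulf_neq0 //.
move=> x y; rewrite {1}(ratfun_numden x) {1}(ratfun_numden y).
by apply: subE; exact: denom_ratioP.
Qed.

Fact laurent_of_ratfun_monoid_morphism : monoid_morphism laurent_of_ratfun.
Proof.
have mulE (p q r s : {poly K}) : q != 0 -> s != 0 ->
    laurent_of_ratfun (p%:F / q%:F * (r%:F / s%:F)) =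
    (fps_of_poly p)%:F / (fps_of_poly q)%:F
      * ((fps_of_poly r)%:F / (fps_of_poly s)%:F).
  by move=> q0 s0; rewrite !mulf_div -!rmorphM laurent_of_ratfunE ?mulf_neq0 //.
split=> [|x y].
  have -> : 1 = 1%:F / 1%:F :> ratfun by rewrite rmorph1 divr1.
  by rewrite laurent_of_ratfunE ?oner_neq0 // !rmorph1 divr1.
rewrite {1}(ratfun_numden x) {1}(ratfun_numden y).
by apply: mulE; exact: denom_ratioP.
Qed.

HB.instance Definition _ := GRing.isZmodMorphism.Build ratfun laurent
  laurent_of_ratfun laurent_of_ratfun_zmod_morphism.
HB.instance Definition _ := GRing.isMonoidMorphism.Build ratfun laurent
  laurent_of_ratfun laurent_of_ratfun_monoid_morphism.

End RationalFunctions.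

(* u is algebraic over F (see algebraicOver) and its minimal polynomial over F
   has degree d, where h embeds F into E. *)
Definition algebraic_degree (F E : fieldType) (h : {rmorphism F -> E})
    (u : E) (d : nat) : Prop :=
  (exists p : {poly F}, [/\ p != 0, root (map_poly h p) u & size p = d.+1]) /\
  (forall p : {poly F}, p != 0 -> root (map_poly h p) u -> (d.+1 <= size p)%N).

Definition gen_fun (a : nat -> nat) : fps rat := FPS (fun n => (a n)%:R).

(* Main.v *)
(** Reversing a word exchanges the two classes, so [d_ n = c_ n].

    Delete the two copies of the largest label from a 123-avoiding word and
    write the result as [C ++ B ++ A]: the word [C n B n A] is again nonnesting
    and 123-avoiding iff [B] has no repeated letter, [C] and [A] share no letter
    and [C ++ B] is weakly decreasing.  The number of admissible insertions and
    the shapes of the results depend only on the initial decreasing run of the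
    word, through two parameters [(a, k)], which yields a succession rule.  Its
    linear system is solved by power series in terms of [K = 1 + z K^2] and
    [y = 2z(1 + y + y^2)]:
      [C(z) = 1 + (K - 1)(1 + y) / (1 - y(K^2 - 1))].

    Here [K] and [y] generate the biquadratic extension of [Q(z)] by the square
    roots [alpha] of [1 - 4z] and [beta] of [(1 - 6z)(1 + 2z)].  As the
    coordinates of [C(z)] along [beta] and [alpha beta] are nonzero, the four
    conjugates of [C(z)] are distinct and its degree is [4].

    The dominant singularity is at [z = 1/6].  Normalise coefficients by [6^n]
    and record the sum and the limit of [n^(3/2) a_n]: these pairs multiply like
    dual numbers under the Cauchy product.  The coefficients of the square roots
    are Wallis integrals, and [1 / (1 - J)] with [J = y(K^2 - 1)] is handled as a
    renewal sequence, since its value at the singularity is less than [1]. *)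

Require Import Defs.
From mathcomp Require Import all_boot all_order all_algebra.
From mathcomp Require Import generic_quotient fraction.
From mathcomp Require Import boolp classical_sets functions reals topology normedtype.
From mathcomp Require Import landau exp trigo sequences derive realfun.
From mathcomp Require Import ring lra zify.

Set Implicit Arguments.
Unset Strict Implicit.
Unset Printing Implicit Defensive.

Import Order.TTheory GRing.Theory Num.Theory.

(** * Insertion of the largest label *)

(** Everything is decided before the first ascent of the word: a [C ++ B] that reaches past it is no
    longer weakly decreasing. The linear system is infinite, but its right-hand side carries a
    factor [z], so it determines every coefficient and a guessed closed form needs only
    verification. No Galois group is constructed: a polynomial evaluated at a combination of
    [1, alpha, beta, alpha beta] has coordinates that do not depend on which square roots were
    chosen, so a zero for one choice of signs is a zero for all four. Values at the singularity are
    not obtained by summing series: the squares are known, limits are unique, and positivity settles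
    the sign. The obstacle in the renewal step is circularity: in [B = 1 + J B] half of the product
    contains the unknown tail of [B]. With [theta = z d/dz] one has [theta B = theta J * B^2]; the
    weight sits on [J], and of the tail of [B^2] only an [O(n^(-3/2))] bound is needed. Hence
    boundedness of [n^(3/2) B_n] is proved before its convergence. *)

Fixpoint cuts (T : Type) (w : seq T) : seq (seq T * seq T) :=
  ([::], w) :: if w is x :: w' then [seq (x :: c.1, c.2) | c <- cuts w'] else [::].

Lemma mem_cuts (T : eqType) (w : seq T) (c : seq T * seq T) :
  (c \in cuts w) = (c.1 ++ c.2 == w).
Proof.
elim: w c => [|x w IHw] [B A] /=; first by rewrite inE xpair_eqE; case: B.
rewrite inE xpair_eqE; case: B => [|b B] /=.
  rewrite eq_sym orbC; case: mapP => [[c _ [] //]|_]; first by [].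
rewrite eqseq_cons; apply/mapP/andP => [[c + [-> -> ->]]|[/eqP-> defw]].
  by rewrite IHw.
by exists (B, A); rewrite // IHw.
Qed.

Lemma cuts_uniq (T : eqType) (w : seq T) : uniq (cuts w).
Proof.
elim: w => //= x w IHw; rewrite map_inj_uniq ?IHw ?andbT; last first.
  by move=> [B A] [B' A'] /= [-> ->].
by apply/mapP => -[].
Qed.

(** The conjuncts exclude, in this order, a pattern [n b b n], a pattern [x n n x], and an ascent
    [x < y] ahead of the second [n]. *)
Definition valid_cut (C B A : seq nat) :=
  [&& uniq B, ~~ has (mem C) A & sorted geq (C ++ B)].

Definition child n (C B A : seq nat) := C ++ n :: B ++ n :: A.

Definition dbl (P : seq nat) := flatten [seq [:: x; x] | x <- P].

Lemma dbl_cons p P : dbl (p :: P) = p :: p :: dbl P.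
Proof. by []. Qed.

Lemma mem_dbl P x : (x \in dbl P) = (x \in P).
Proof. by elim: P => //= p P IHP; rewrite !inE IHP orbA orbb. Qed.

Lemma dbl_cat P Q : dbl (P ++ Q) = dbl P ++ dbl Q.
Proof. by rewrite /dbl map_cat flatten_cat. Qed.

Arguments dbl : simpl never.

Lemma sorted_dbl P S : sorted gtn (P ++ S) -> sorted geq (dbl P ++ S).
Proof.
have gtn_tr : transitive gtn by move=> y x z /= xy yz; exact: ltn_trans yz xy.
have geq_tr : transitive geq by move=> y x z /= xy yz; exact: leq_trans yz xy.
rewrite (sorted_pairwise gtn_tr) (sorted_pairwise geq_tr).
elim: P => [|p P IHP]; rewrite ?dbl_cons /=; first by apply: sub_pairwise => x y /ltnW.
case/andP=> /allP pP /IHP ->; rewrite leqnn !andbT /= andbb; apply/allP => x.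
by rewrite mem_cat mem_dbl -mem_cat => /pP/ltnW.
Qed.

(* The initial weakly decreasing run of [w] consists of [k] pairs of equal
   letters followed by [a] letters whose second copy comes after the run. *)
Definition state n (w : seq nat) a k := exists P S R,
  [/\ w = dbl P ++ S ++ R, size S = a, size P = k & sorted gtn (P ++ S)] /\
  [/\ all (gtn n) w, {subset S <= R}, ~~ has (mem P) R &
      R = [::] \/ P ++ S <> [::] /\ last 0 (P ++ S) < head 0 R].

(** * The succession rule for insertions *)

Section ChildSum.
Local Open Scope ring_scope.
Variable V : nmodType.

(** For [k > 0] the first two terms have [C] empty. A [C] that ends inside or just after a pair
    other than the last leaves two choices of [B]; at the last pair [B] may also run through any
    prefix of the [a] single letters, whence [a + 1] choices. For [k = 0], [C] is empty and [B] is a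
    prefix of the single letters. *)
Definition succession_rule (phi : nat -> nat -> V) a k : V :=
  if k is k'.+1 then
    phi a k.+1 + phi 2%N 0%N + (\sum_(j < k') (phi 0%N j.+1 + phi 1%N j)) *+ 2
      + (phi 0%N k + phi 1%N k') *+ a.+1
  else phi a 1%N + \sum_(q < a) phi q.+2 0.

Definition child_sum n (phi : seq nat -> V) w : V :=
  \sum_(c <- cuts w) \sum_(b <- cuts c.2 | valid_cut c.1 b.1 b.2)
    phi (child n c.1 b.1 b.2).

Variables (n : nat) (phi : seq nat -> V) (psi : nat -> nat -> V).
Hypothesis phi_state : forall w a k, state n.+1 w a k -> phi w = psi a k.

(** The letters already assigned to [C] and [B] are accumulators, so that the sum over cuts can be
    peeled off one letter at a time. *)
Definition inner_sum C B0 w : V :=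
  \sum_(b <- cuts w | valid_cut C (B0 ++ b.1) b.2) phi (child n C (B0 ++ b.1) b.2).

Definition outer_sum C0 w : V :=
  \sum_(c <- cuts w) inner_sum (C0 ++ c.1) [::] c.2.

Lemma inner_sum_cons C B0 x w : inner_sum C B0 (x :: w) =
  (if valid_cut C B0 (x :: w) then phi (child n C B0 (x :: w)) else 0)
    + inner_sum C (B0 ++ [:: x]) w.
Proof.
rewrite /inner_sum /= big_cons cats0 big_map /=.
under eq_bigl do rewrite -cat1s catA.
under eq_bigr do rewrite -cat1s catA.
by case: ifP => // _; rewrite add0r.
Qed.

Lemma outer_sum_cons C0 x w : outer_sum C0 (x :: w) =
  inner_sum C0 [::] (x :: w) + outer_sum (C0 ++ [:: x]) w.
Proof.
rewrite /outer_sum /= big_cons cats0 big_map /=; congr (_ + _).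
by under eq_bigr do rewrite -cat1s catA.
Qed.

Lemma inner_sum_eq0 C B0 w :
  ~~ (uniq B0 && sorted geq (C ++ B0)) -> inner_sum C B0 w = 0.
Proof.
move=> bad; rewrite /inner_sum big1_seq // => b /andP[/and3P[u _ s] _].
case/negP: bad; move: u s; rewrite cat_uniq => /andP[-> _] /=.
by rewrite catA => /cat_sorted2[].
Qed.

(** Within the decreasing run every prefix is admissible; the ascent at the head of [R] stops [B]
    there. *)
Lemma inner_sum_run (C B0 S R : seq nat) :
    uniq (B0 ++ S) -> ~~ has (mem C) (S ++ R) -> sorted geq (C ++ B0 ++ S) ->
    R = [::] \/ C ++ B0 ++ S <> [::] /\ (last 0 (C ++ B0 ++ S) < head 0 R)%N ->
  inner_sum C B0 (S ++ R) =
    \sum_(i < (size S).+1) phi (child n C (B0 ++ take i S) (drop i S ++ R)).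
Proof.
elim: S B0 => [|s S IHS] B0 uS CR sS hR.
  rewrite big_ord1 /= cats0 /inner_sum.
  case: R CR hR => [|r R] CR hR /=; rewrite big_cons cats0 /valid_cut ?CR.
    by move: uS sS; rewrite cats0 => -> -> /=; rewrite big_nil addr0.
  move: uS sS hR; rewrite !cats0 => -> -> [//|[nz hR]] /=.
  rewrite big1_seq ?addr0 // => b /andP[/and3P[_ _ sb]] /mapP[c _ eb].
  move: sb; rewrite {}eb /= catA -cat_rcons => /cat_sorted2[+ _].
  move: nz hR; case/lastP: (C ++ B0) => // q x _; rewrite last_rcons => xr.
  by rewrite -!cats1 -catA => /cat_sorted2[_] /=; rewrite leqNgt xr.
rewrite /= inner_sum_cons big_ord_recl /= cats0; congr (_ + _).
  move: sS uS; rewrite /valid_cut CR catA => /cat_sorted2[-> _].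
  by rewrite cat_uniq => /andP[-> _].
rewrite IHS -?catA //=; last by move: CR => /= /norP[].
by apply: eq_bigr => i _; rewrite -catA.
Qed.

Lemma inner_sum_pair C B0 p w :
    uniq (B0 ++ [:: p]) -> ~~ has (mem C) (p :: w) -> sorted geq (C ++ B0 ++ [:: p]) ->
  inner_sum C B0 (p :: p :: w) =
    phi (child n C B0 (p :: p :: w)) + phi (child n C (B0 ++ [:: p]) (p :: w)).
Proof.
move=> up Cw sp; rewrite !inner_sum_cons /valid_cut up Cw sp /=.
move: sp up Cw; rewrite catA => /cat_sorted2[-> _].
rewrite cat_uniq => /andP[-> _] /= /norP[pC Cw]; rewrite (negbTE pC) (negbTE Cw) /=.
rewrite inner_sum_eq0 ?addr0 // -catA /=.
by rewrite cat_uniq /= inE eqxx /= !andbF.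
Qed.

(** The inserted [n] exceeds all other letters, so it creates an ascent right after a nonempty [C]:
    the initial run of the child is [C] itself. *)
Lemma state_child C P0 S0 B A : C = dbl P0 ++ S0 -> C <> [::] ->
    sorted gtn (P0 ++ S0) -> all (gtn n) (C ++ B ++ A) ->
    {subset S0 <= B ++ A} -> ~~ has (mem P0) (B ++ A) ->
  state n.+1 (child n C B A) (size S0) (size P0).
Proof.
move=> defC C0 sC allC subS dis; exists P0, S0, (n :: B ++ n :: A).
have allP0 x : x \in P0 ++ S0 -> (x < n)%N.
  move=> xPS; apply: (allP allC); rewrite mem_cat defC.
  by move: xPS; rewrite !mem_cat mem_dbl => ->.
split; split=> //.
- by rewrite /child defC -catA.
- have: all (gtn n.+1) (C ++ B ++ A) by apply: sub_all allC => x /ltnW.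
  by rewrite /child !all_cat /= ltnSn !all_cat /= ltnSn => /and3P[-> -> ->].
- by move=> x /subS; rewrite inE !mem_cat inE => /orP[]->; rewrite ?orbT.
- have nP : n \notin P0.
    by apply/negP => /= nP; have := allP0 n; rewrite mem_cat nP ltnn => /(_ isT).
  apply/hasPn => x; rewrite inE mem_cat inE => /or4P[/eqP->|xB|/eqP->|xA] //.
  + by apply: (hasPn dis); rewrite mem_cat xB.
  + by apply: (hasPn dis); rewrite mem_cat xA orbT.
right; have PS0 : P0 ++ S0 <> [::] by move: C0; rewrite defC; case: (P0) (S0) => [|? ?] [].
split=> //=; apply: allP0; move: PS0; case: (P0 ++ S0) => // x s _ /=; exact: mem_last.
Qed.

Lemma run_prefix (C D T S R : seq nat) :
    D ++ T = S ++ R -> sorted geq (C ++ D) ->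
    R = [::] \/ C ++ S <> [::] /\ (last 0 (C ++ S) < head 0 R)%N ->
  exists2 S', S = D ++ S' & T = S' ++ R.
Proof.
elim: D C S => [|d D IHD] C S /=; first by move=> ->; exists S.
case: S => [|s S] /=.
  case: R IHD => // r R _ [<- _] sC [//|[]]; rewrite cats0.
  case/lastP: C sC => // C x sC _; rewrite last_rcons /= => xd.
  move: sC; rewrite -cats1 -catA => /cat_sorted2[_] /=.
  by rewrite leqNgt xd.
case=> <- eDT sC hR; have := IHD (C ++ [:: d]) S eDT; rewrite -!catA.
by case=> // S' -> ->; exists S'.
Qed.

(** A letter of [S] moved into [C] occurs again in [R]. Since [B] cannot cross the ascent at the
    head of [R], that second copy stays in [A], which must avoid [C]. *)
Lemma outer_sum_run (C S R : seq nat) :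
    sorted geq (C ++ S) -> {subset S <= R} ->
    R = [::] \/ C ++ S <> [::] /\ (last 0 (C ++ S) < head 0 R)%N ->
  outer_sum C (S ++ R) = inner_sum C [::] (S ++ R).
Proof.
move=> sS subS hR; rewrite /outer_sum.
case defw: (S ++ R) => [|x w] /=; first by rewrite big_seq1 cats0.
rewrite big_cons cats0 /= big_map big1_seq ?addr0 // => c /andP[_].
rewrite mem_cuts => /eqP defc /=; rewrite /inner_sum big1_seq // => b /=.
case/andP=> /and3P[_ /hasPn dis sb]; rewrite mem_cuts => /eqP defb.
have defw' : (x :: c.1 ++ b.1) ++ b.2 = S ++ R by rewrite defw -defc -defb /= catA.
have [|S' defS defb2] := run_prefix defw' _ hR; first by rewrite -catA in sb.
have /subS xR : x \in S by rewrite defS mem_head.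
have /dis /= : x \in b.2 by rewrite defb2 mem_cat xR orbT.
by rewrite mem_cat mem_head orbT.
Qed.

Lemma inner_sum_run_state (P0 S0 B0 S R : seq nat) (C := dbl P0 ++ S0) :
    C <> [::] -> sorted gtn (P0 ++ S0) -> {subset S0 <= B0} ->
    all (gtn n) (C ++ B0 ++ S ++ R) -> ~~ has (mem P0) (B0 ++ S ++ R) ->
    uniq (B0 ++ S) -> ~~ has (mem C) (S ++ R) -> sorted geq (C ++ B0 ++ S) ->
    R = [::] \/ (last 0 (C ++ B0 ++ S) < head 0 R)%N ->
  inner_sum C B0 (S ++ R) = psi (size S0) (size P0) *+ (size S).+1.
Proof.
move=> C0 sC subB0 aC disP0 uS disC sS hR; rewrite inner_sum_run //; last first.
  by case: hR => hR; [left | right; split=> //; case: (C) C0].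
rewrite -[X in _ *+ X]card_ord -sumr_const; apply: eq_bigr => i _.
apply: phi_state; apply: (state_child (erefl _)) => //.
- by rewrite -(catA B0) (catA (take i S)) cat_take_drop.
- by move=> x /subB0 xB0; rewrite !mem_cat xB0.
- by rewrite -catA (catA (take i S)) cat_take_drop.
Qed.

Lemma inner_sum_pair_state (P0 S0 B0 : seq nat) p w (C := dbl P0 ++ S0) :
    C <> [::] -> sorted gtn (P0 ++ S0) -> {subset S0 <= B0} ->
    all (gtn n) (C ++ B0 ++ p :: p :: w) -> ~~ has (mem P0) (B0 ++ p :: p :: w) ->
    uniq (B0 ++ [:: p]) -> ~~ has (mem C) (p :: w) -> sorted geq (C ++ B0 ++ [:: p]) ->
  inner_sum C B0 (p :: p :: w) = psi (size S0) (size P0) *+ 2.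
Proof.
move=> C0 sC subB0 aC disP0 uS disC sS; rewrite inner_sum_pair // mulr2n.
congr (_ + _); apply: phi_state; apply: (state_child (erefl _)) => //.
- by move=> x /subB0 xB0; rewrite mem_cat xB0.
- by rewrite -(catA B0).
- by move=> x /subB0 xB0; rewrite !mem_cat xB0.
- by rewrite -(catA B0).
Qed.

Section Pairs.
Variables S R : seq nat.
Hypothesis subS : {subset S <= R}.

Definition pairs_ok P0 P := [/\ sorted gtn (P0 ++ P ++ S),
  all (gtn n) (dbl P0 ++ dbl P ++ S ++ R), ~~ has (mem (P0 ++ P)) R &
  R = [::] \/ P0 ++ P ++ S <> [::] /\ (last 0 (P0 ++ P ++ S) < head 0 R)%N].

Lemma pairs_okP P0 p P1 : pairs_ok P0 (p :: P1) ->
  [/\ sorted geq (dbl P0 ++ p :: p :: dbl P1 ++ S),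
      uniq (p :: P1 ++ S), ~~ has (mem (dbl P0 ++ [:: p])) (dbl P1 ++ S ++ R),
      sorted gtn (P0 ++ [:: p]) & ~~ has (mem P0) (p :: p :: dbl P1 ++ S ++ R)].
Proof.
case=> sP _ /hasPn dP _; have uP : uniq (P0 ++ p :: P1 ++ S).
  apply: sorted_uniq sP => [y x z /= xy yz|x /=]; [exact: ltn_trans yz xy | exact: ltnn].
have dis0 x : x \in p :: dbl P1 ++ S ++ R -> x \notin P0.
  have [/dP /=|xR] := boolP (x \in R); first by rewrite mem_cat => /norP[].
  rewrite inE !mem_cat mem_dbl (negbTE xR) orbF => xT.
  apply: contraTN uP => xP; rewrite cat_uniq !negb_and negbK; apply/or3P/Or32.
  by apply/hasP; exists x; rewrite // inE mem_cat.
have dis1 x : x \in dbl P1 ++ S ++ R -> x != p.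
  have [/dP /=|xR] := boolP (x \in R).
    by rewrite mem_cat inE => /norP[_ /norP[]].
  rewrite !mem_cat mem_dbl (negbTE xR) orbF -mem_cat => xT.
  by apply: contraTneq uP => <-; rewrite cat_uniq /= xT /= !andbF.
split.
- have := sorted_dbl (P := P0 ++ p :: P1) (S := S); rewrite -catA => /(_ sP).
  by rewrite dbl_cat -catA.
- apply: subseq_uniq uP; exact: suffix_subseq.
- apply/hasPn => x xT /=; rewrite mem_cat mem_dbl negb_or inE dis1 // dis0 //.
  by rewrite inE xT orbT.
- by move: sP; rewrite -[p :: _]cat1s -catA catA => /cat_sorted2[].
apply/hasPn => x; rewrite !inE orbA orbb => /= xT; apply: dis0.
by rewrite inE.
Qed.

Lemma pairs_ok_cat P0 p P1 : pairs_ok P0 (p :: P1) -> pairs_ok (P0 ++ [:: p]) P1.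
Proof. by rewrite /pairs_ok dbl_cat -!catA. Qed.

(** Starting between the two copies of [p] groups the cut inside a pair with the cut after it, which
    is one summand of the rule. For the cut inside, the second [p] must open [B], or [C] and [A]
    would share it. *)
Lemma outer_sum_half P0 p P1 : pairs_ok P0 (p :: P1) ->
  inner_sum (dbl P0 ++ [:: p]) [::] (p :: dbl P1 ++ S ++ R) +
    outer_sum (dbl (P0 ++ [:: p])) (dbl P1 ++ S ++ R) =
  (\sum_(j < size P1) (psi 0%N (size P0 + j).+1 + psi 1%N (size P0 + j))) *+ 2
  + (psi 0%N (size P0 + size P1).+1 + psi 1%N (size P0 + size P1)) *+ (size S).+1.
Proof.
have dblS P x : dbl (P ++ [:: x]) = (dbl P ++ [:: x]) ++ [:: x].
  by rewrite dbl_cat -catA.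
have nz P x : dbl (P ++ [:: x]) ++ [::] <> [::] by rewrite cats0 dblS; case: (dbl P).
elim: P1 P0 p => [|q P1 IHP1] P0 p ok;
  have [sP aP dP hR] := ok; have [sd uP dis sP0 disP0] := pairs_okP ok.
  rewrite big_ord0 mul0rn add0r addn0 mulrnDl [RHS]addrC; congr (_ + _).
    rewrite inner_sum_cons /valid_cut /= mem_cat mem_head orbT /= add0r.
    rewrite (@inner_sum_run_state P0 [:: p]) //.
    - by case: (dbl P0).
    - by rewrite -catA.
    - by case/norP: disP0.
    - by rewrite -catA.
    - case: hR => [|[_ hR]]; [by left | right].
      by move: hR; rewrite !last_cat.
  rewrite cat0s in dis sd disP0 *; rewrite outer_sum_run //.
  - rewrite -[X in inner_sum X]cats0 (@inner_sum_run_state _ [::] [::] S R) //.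
    + by rewrite size_cat addn1.
    + by rewrite cats0.
    + by rewrite cats0 dblS -!catA.
    + by apply/hasPn => x /(hasPn dis) /=; rewrite !mem_cat mem_dbl.
    + by case/andP: uP.
    + rewrite cats0; apply/hasPn => x /(hasPn dis) /=.
      by rewrite dblS !mem_cat mem_dbl -orbA orbb.
    + by rewrite cats0 dblS -!catA.
    + case: hR => [|[_ hR]]; [by left | right].
      by move: hR; rewrite cats0 /= dblS !last_cat.
  - by rewrite dblS -!catA.
  - case: hR => [|[_ hR]]; [by left | right; split].
      by rewrite dblS; case: (dbl P0).
    by move: hR; rewrite dblS !last_cat.
have ok' := pairs_ok_cat ok; have [sd' uS' dis' sP0' disP0'] := pairs_okP ok'.
rewrite dbl_cons inner_sum_cons /valid_cut /= mem_cat mem_head orbT /= add0r.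
rewrite !outer_sum_cons -dblS IHP1 //.
rewrite (@inner_sum_pair_state P0 [:: p]) //; last first.
- move: sd; rewrite dbl_cons -!catA -(cat1s p) -(cat1s p (q :: _)) -(cat1s q) -(cat1s q).
  by rewrite !catA => /cat_sorted2[/cat_sorted2[]].
- by apply/hasPn => x xq; apply: (hasPn dis); rewrite dbl_cons inE orbC xq.
- by move: uP; rewrite /= !inE => /andP[/norP[->]].
- by case/norP: disP0.
- by rewrite -!catA.
- by case: (dbl P0).
rewrite -[X in inner_sum X]cats0 (@inner_sum_pair_state _ [::] [::]) //; last first.
- by rewrite cats0 /=; move: sd'; rewrite -(cat1s q) catA => /cat_sorted2[].
- rewrite cats0; apply/hasPn => x xq /=; rewrite mem_dbl.
  by apply: (hasPn disP0'); rewrite inE orbC xq.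
- by rewrite cats0 dblS; move: aP; rewrite -!catA.
- by rewrite cats0.
rewrite big_ord_recl /= addn0 size_cat addn1 !addnS !addSn.
under [in RHS]eq_bigr do rewrite /bump /= add1n addnS -addSn.
under eq_bigr do rewrite addSn.
have reorder (x y s t : V) : x *+ 2 + (y *+ 2 + (s *+ 2 + t)) = (y + x + s) *+ 2 + t.
  by rewrite !mulrnDl addrA [x *+ 2 + _]addrC -[RHS]addrA.
exact: reorder.
Qed.

End Pairs.

Lemma state_top w a k : state n w a k -> state n.+1 (n :: n :: w) a k.+1.
Proof.
case=> P [S [R [[-> <- <- sP] [aw subS dis hR]]]]; exists (n :: P), S, R.
have aPS : all (gtn n) (P ++ S).
  apply/allP => x; rewrite mem_cat => xPS; apply: (allP aw).
  by rewrite !mem_cat mem_dbl orbA xPS.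
have aR : all (gtn n) R by move: aw; rewrite !all_cat => /and3P[].
split; split=> //=.
- by rewrite (path_sortedE (fun y x z xy yz => ltn_trans yz xy)) aPS.
- by rewrite ltnSn /=; apply: sub_all aw => x /ltnW.
- apply/hasPn => x xR /=; rewrite inE negb_or (hasPn dis) // andbT.
  by have /= xn := allP aR x xR; rewrite neq_ltn xn.
case: hR => [|[PS0 hR]]; [by left | right; split=> //].
by move: PS0 hR; case: (P ++ S).
Qed.

Lemma state_front B A : all (gtn n) (B ++ A) -> sorted gtn B ->
  {subset B <= A} -> B <> [::] -> state n.+1 (child n [::] B A) (size B).+1 0%N.
Proof.
move=> aBA sB subB B0; exists [::], (n :: B), (n :: A).
have [aB aA] : all (gtn n) B /\ all (gtn n) A by move: aBA; rewrite all_cat => /andP[].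
split; split=> //=.
- by rewrite (path_sortedE (fun y x z xy yz => ltn_trans yz xy)) aB.
- rewrite ltnSn all_cat /= ltnSn /=; apply/andP; split.
    by apply: sub_all aB => x /ltnW.
  by apply: sub_all aA => x /ltnW.
- by move=> x; rewrite !inE => /orP[->//|/subB ->]; rewrite orbT.
- by apply/hasPn.
right; split=> //; apply: (allP aB); case: (B) B0 => //= x s _; exact: mem_last.
Qed.

Lemma child_sum_state w a k : state n w a k -> child_sum n phi w = succession_rule psi a k.
Proof.
move=> st; have [P [S [R [[defw eS eP sP] [aw subS dis hR]]]]] := st.
rewrite -{}eS -{}eP in st *.
have uPS : uniq (P ++ S).
  by apply: sorted_uniq sP => [y x z /= xy yz|x /=]; [exact: ltn_trans yz xy | exact: ltnn].
rewrite -[child_sum n phi w]/(outer_sum [::] w) defw.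
case: P => [|p P1] in st defw sP aw dis hR uPS *.
  rewrite cat0s outer_sum_run //=; last by rewrite -[S]cat0s; apply: (@sorted_dbl [::]).
  rewrite inner_sum_run ?cat0s //; last first.
  - by rewrite -[S]cat0s; apply: (@sorted_dbl [::]).
  - by apply/hasPn.
  rewrite big_ord_recl /= take0 drop0; congr (_ + _).
    apply: phi_state; rewrite -[child _ _ _ _]/(n :: n :: S ++ R).
    by rewrite -[S ++ R]/(dbl [::] ++ S ++ R) -defw; apply: state_top.
  apply: eq_bigr => i _; apply: phi_state.
  have szi : size (take i.+1 S) = i.+1 by rewrite size_take_min; apply/minn_idPl/ltn_ord.
  rewrite -[X in state _ _ X.+1]szi; apply: state_front.
  - by rewrite catA cat_take_drop; move: aw; rewrite defw.
  - by have := sP; rewrite cat0s -{1}(cat_take_drop i.+1 S) => /cat_sorted2[].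
  - by move=> x /mem_take /subS xR; rewrite mem_cat xR orbT.
  - by move=> e; rewrite e in szi.
rewrite dbl_cons !cat_cons outer_sum_cons inner_sum_pair //.
rewrite outer_sum_cons -[([::] ++ _) ++ _]/(dbl ([::] ++ [:: p])).
rewrite -[[::] ++ [:: p]]/(dbl [::] ++ [:: p]) outer_sum_half //; last first.
  split=> //; first by rewrite -defw.
rewrite /= !addrA; congr (_ + _ + _ + _).
  congr (_ + _); apply: phi_state.
    rewrite -[child _ _ _ _]/(n :: n :: dbl (p :: P1) ++ S ++ R) -defw.
    exact: state_top.
  rewrite -[2%N]/((size [:: p]).+1); apply: state_front => //.
    by move: aw; rewrite defw.
  by move=> x; rewrite !inE => ->.
by apply/hasPn.
Qed.

End ChildSum.

(** * Nonnesting 123-avoiding words as sequences *)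

Lemma subseq_nthP (T : eqType) (x0 : T) (s t : seq T) :
  subseq s t <-> exists I, [/\ sorted ltn I, all (gtn (size t)) I &
                             s = [seq nth x0 t i | i <- I]].
Proof.
split=> [/subseqP[m szm ->]|[I [sI aI ->]]].
  exists (mask m (iota 0 (size t))); split.
  - by apply: (sorted_mask ltn_trans); exact: iota_ltn_sorted.
  - by apply/allP => i /mem_mask; rewrite mem_iota.
  - by rewrite map_mask map_nth_iota0 // take_size.
rewrite -{2}(take_size t) -(map_nth_iota0 x0) //; apply: map_subseq.
apply/subseq_uniqP; first exact: iota_uniq.
apply: (irr_sorted_eq ltn_trans ltnn) => //.
  by apply: (sorted_filter ltn_trans); exact: iota_ltn_sorted.
move=> i; rewrite mem_filter mem_iota; case: (boolP (i \in I)) => //.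
by move/(allP aI) => /= ->.
Qed.

(** Patterns are subsequences rather than tuples of positions, so that they pass directly through
    deletion and insertion of letters. *)
Definition nn123 n (w : seq nat) :=
  [/\ all (gtn n) w, forall a, a < n -> count_mem a w = 2,
      forall a b, a != b -> ~~ subseq [:: a; b; b; a] w &
      forall x y z, x < y -> y < z -> ~~ subseq [:: x; y; z] w].

Section SubseqAux.
Variable T : eqType.
Implicit Types (s t C A : seq T).

Lemma subseq_skip a s C t : a \notin C -> subseq (a :: s) (C ++ t) = subseq (a :: s) t.
Proof.
elim: C => //= c C IHC; rewrite inE negb_or => /andP[ac aC].
by rewrite (negbTE ac) IHC.
Qed.

Lemma subseq_head a s C t :
  a \notin C -> subseq (a :: s) (C ++ a :: t) = subseq s t.
Proof. by move=> aC; rewrite subseq_skip //= eqxx. Qed.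

Lemma subseq_skip_last a s A t :
  a \notin A -> subseq (rcons s a) (t ++ A) = subseq (rcons s a) t.
Proof.
move=> aA; rewrite -subseq_rev rev_cat rev_rcons subseq_skip ?mem_rev //.
by rewrite -rev_rcons subseq_rev.
Qed.

Lemma subseq_last a s A t :
  a \notin A -> subseq (rcons s a) (t ++ a :: A) = subseq s t.
Proof.
move=> aA; rewrite -cat_rcons subseq_skip_last // -subseq_rev !rev_rcons /=.
by rewrite eqxx subseq_rev.
Qed.

Lemma not_uniq_subseq s : ~~ uniq s -> exists b, subseq [:: b; b] s.
Proof.
elim: s => //= x s IHs; rewrite negb_and negbK => /orP[xs|/IHs[b sb]].
  by exists x; rewrite eqxx sub1seq.
by exists b; apply: subseq_trans sb (subseq_cons _ _).
Qed.

Lemma not_sorted_subseq (r : rel T) s :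
  ~~ sorted r s -> exists x y, ~~ r x y /\ subseq [:: x; y] s.
Proof.
elim: s => // x [|y s] IHs //=; rewrite negb_and => /orP[rxy|].
  by exists x, y; rewrite rxy !eqxx sub0seq.
case/IHs=> a [b [rab sab]]; exists a, b; split=> //.
exact: subseq_trans sab (subseq_cons _ _).
Qed.

End SubseqAux.

Lemma filter_child n C B A : n \notin C ++ B ++ A ->
  [seq x <- child n C B A | x != n] = C ++ B ++ A.
Proof.
move=> nw; rewrite /child filter_cat /= eqxx filter_cat /= eqxx -!filter_cat.
by apply/all_filterP/allP => x; apply: contraTneq => ->.
Qed.

Lemma subseq_child n C B A : subseq (C ++ B ++ A) (child n C B A).
Proof.
rewrite /child subseq_cat2l; apply: subseq_trans (subseq_cons _ _).
by rewrite subseq_cat2l subseq_cons.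
Qed.

Lemma nn123_notin n w : nn123 n w -> n \notin w.
Proof. by case=> /allP aw _ _ _; apply/negP => /aw; rewrite /= ltnn. Qed.

Lemma count_child n C B A (p : pred nat) :
  count p (child n C B A) = 2 * p n + count p (C ++ B ++ A).
Proof.
rewrite /child !count_cat /= count_cat /=; lia.
Qed.

Lemma nn123_child n C B A :
  nn123 n (C ++ B ++ A) -> valid_cut C B A -> nn123 n.+1 (child n C B A).
Proof.
move=> gw; have nw := nn123_notin gw; case: gw => aw cw nnw avw.
have sub_old s : n \notin s -> subseq s (child n C B A) -> subseq s (C ++ B ++ A).
  move=> ns sw; rewrite -(filter_child nw) subseq_filter sw andbT.
  by apply/allP => x; apply: contraTneq => ->.
have := nw; rewrite !mem_cat !negb_or => /and3P[nC nB nA].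
case/and3P=> uB dis sCB.
have aw' : all (gtn n.+1) (child n C B A).
  have : all (gtn n.+1) (C ++ B ++ A) by apply: sub_all aw => x /ltnW.
  by rewrite /child !all_cat /= ltnSn !all_cat /= ltnSn.
split=> //.
- move=> a; rewrite ltnS leq_eqVlt => /predU1P[->|an]; rewrite count_child.
    by rewrite /= eqxx (count_memPn nw).
  by rewrite cw //= gtn_eqF.
- move=> a b ab; apply/negP => sw.
  have [an|an] := eqVneq a n.
    move: sw; rewrite an /child subseq_head // -[[:: b; b; n]]/(rcons [:: b; b] n).
    rewrite subseq_last // => sB; have := subseq_uniq sB uB.
    by rewrite /= inE eqxx.
  have [bn|bn] := eqVneq b n; last first.
    case/negP: (nnw a b ab); apply: sub_old sw.
    by rewrite !inE !negb_or ![n == _]eq_sym an bn.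
  (* The pattern [a n n a] needs both copies of [n] between its outer letters. If [a] were missing
     from [A] or from [C], only a part of the word with a single [n] would remain for the inner
     letters. *)
  have count_n (X : seq nat) : n \notin X -> count_mem n (n :: X) = 1.
    by move=> nX; rewrite /= eqxx (count_memPn nX).
  move: sw; rewrite bn => sw; case/negP: dis; apply/hasP; exists a;
    apply: contraLR sw => aA.
    rewrite -[[:: a; n; n; a]]/(rcons [:: a; n; n] a) /child.
    rewrite -cat_cons catA subseq_skip_last; last by rewrite inE negb_or an.
    apply/negP => /(@leq_count_subseq _ (pred1 n)).
    by rewrite count_cat (count_memPn nC) count_n //= eqxx !addnS.
  rewrite /child -cat_rcons subseq_skip; last by rewrite mem_rcons inE negb_or an.
  apply/negP => /(@leq_count_subseq _ (pred1 n)).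
  by rewrite count_cat (count_memPn nB) count_n //= eqxx !addnS.
move=> x y z xy yz; apply/negP => sw.
have /(allP aw') /= : z \in child n C B A.
  by apply: (mem_subseq sw); rewrite !inE eqxx !orbT.
rewrite ltnS leq_eqVlt => /predU1P[zn|zn]; last first.
  case/negP: (avw x y z xy yz); apply: sub_old sw.
  by rewrite !inE !negb_or !gtn_eqF // (ltn_trans yz, ltn_trans xy) // (ltn_trans yz).
move: sw; rewrite zn -[[:: x; y; n]]/(rcons [:: x; y] n) in yz *.
rewrite /child -cat_cons catA subseq_last // => sxy.
have : subseq [:: x; y] (C ++ B).
  have -> : C ++ B = [seq u <- C ++ n :: B | u != n].
    rewrite filter_cat /= eqxx -filter_cat; apply/esym/all_filterP/allP => u.
    by apply: contraTneq => ->; rewrite mem_cat negb_or nC.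
  by rewrite subseq_filter sxy /= !neq_ltn yz (ltn_trans xy).
have geq_tr : transitive geq by move=> b a c /= ab bc; exact: leq_trans bc ab.
by move/(subseq_sorted geq_tr)/(_ sCB); rewrite /= andbT leqNgt xy.
Qed.

Lemma nn123_parent n w : nn123 n.+1 w -> exists C B A,
  [/\ w = child n C B A, nn123 n (C ++ B ++ A) & valid_cut C B A].
Proof.
case=> aw cw nnw avw.
have [C [B [A [defw nw]]]] : exists C B A, w = child n C B A /\ n \notin C ++ B ++ A.
  have ex_first X : 0 < count_mem n X -> exists C D, X = C ++ n :: D /\ n \notin C.
    rewrite -has_count has_pred1 => nX.
    exists (take (index n X) X), (drop (index n X).+1 X).
    rewrite -{2}(nth_index n nX) -drop_nth ?index_mem // cat_take_drop; split=> //.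
    by apply/negP => /index_ltn; rewrite ltnn.
  have cn := cw n (ltnSn n); have [|C [D [eD nC]]] := ex_first w; first by rewrite cn.
  have cD : count_mem n D = 1.
    by move: cn; rewrite eD count_cat (count_memPn nC) /= eqxx; lia.
  have [|B [A [eA nB]]] := ex_first D; first by rewrite cD.
  have /count_memPn nA : count_mem n A = 0.
    by move: cD; rewrite eA count_cat (count_memPn nB) /= eqxx; lia.
  by exists C, B, A; rewrite eD eA !mem_cat !negb_or nC nB nA.
exists C, B, A; split=> //.
  have sub_w : subseq (C ++ B ++ A) w by rewrite defw subseq_child.
  split.
  - apply/allP => x xw; have /(allP aw) := mem_subseq sub_w xw.
    rewrite /= ltnS leq_eqVlt => /predU1P[xn|//].
    by rewrite xn (negbTE nw) in xw.
  - move=> a an; have := cw a (ltnW an); rewrite defw count_child /=.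
    by rewrite gtn_eqF.
  - by move=> a b ab; apply: contra (nnw a b ab) => /subseq_trans; apply.
  - by move=> x y z xy yz; apply: contra (avw x y z xy yz) => /subseq_trans; apply.
have lt_n x : x \in C ++ B ++ A -> x < n.
  move=> xw; have : x \in child n C B A by apply: mem_subseq xw; exact: subseq_child.
  rewrite -defw => /(allP aw); rewrite /= ltnS leq_eqVlt => /predU1P[xn|//].
  by rewrite -xn xw in nw.
apply/and3P; split.
- apply: contraT => /not_uniq_subseq[b sb].
  have bn : n != b.
    apply: contraNneq nw => ->; rewrite !mem_cat (mem_subseq sb) ?mem_head ?orbT //.
  case/negP: (nnw n b bn); rewrite defw /child.
  apply: subseq_trans (suffix_subseq _ _); rewrite /= eqxx.
  rewrite -[[:: b; b; n]]/([:: b; b] ++ [:: n]); apply: cat_subseq => //.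
  by rewrite /= eqxx sub0seq.
- apply/hasPn => x xA /=; apply/negP => xC.
  have xn : x != n by rewrite neq_ltn lt_n // !mem_cat xC.
  case/negP: (nnw x n xn); rewrite defw /child.
  rewrite -[[:: x; n; n; x]]/([:: x] ++ [:: n] ++ [::] ++ [:: n] ++ [:: x]).
  rewrite -[n :: B ++ n :: A]/([:: n] ++ B ++ [:: n] ++ A).
  by do !apply: cat_subseq; rewrite ?sub1seq ?sub0seq ?inE.
apply: contraT => /not_sorted_subseq[x [y [+ sxy]]]; rewrite /= -ltnNge => xy.
have yn : y < n.
  by apply: lt_n; rewrite catA mem_cat (mem_subseq sxy) // !inE eqxx orbT.
case/negP: (avw x y n xy yn); rewrite defw /child.
have -> : C ++ n :: B ++ n :: A = ((C ++ n :: B) ++ [:: n]) ++ A by rewrite -!catA.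
apply: subseq_trans (prefix_subseq _ _).
rewrite -[[:: x; y; n]]/([:: x; y] ++ [:: n]); apply: cat_subseq => //.
apply: subseq_trans sxy _; apply: cat_subseq => //; exact: subseq_cons.
Qed.

Lemma cat_cons_inj (T : eqType) (n : T) C C' X X' :
  n \notin C -> n \notin C' -> C ++ n :: X = C' ++ n :: X' -> C = C' /\ X = X'.
Proof.
elim: C C' => [|c C IHC] [|c' C'] /=; rewrite ?inE ?negb_or.
- by move=> _ _ [].
- by move=> _ /andP[/eqP nc _] [].
- by move=> /andP[/eqP nc _] _ [/esym].
by move=> /andP[_ nC] /andP[_ nC'] [-> /IHC[] // -> ->].
Qed.

(** * The generating tree *)

Definition children n (w : seq nat) := [seq child n c.1 b.1 b.2 |
  c <- cuts w, b <- [seq b <- cuts c.2 | valid_cut c.1 b.1 b.2]].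

Fixpoint nn123_words n : seq (seq nat) :=
  if n is m.+1 then [seq w' | w <- nn123_words m, w' <- children m w] else [:: [::]].

Lemma mem_children n w w' : w' \in children n w <->
  exists C B A, [/\ w = C ++ B ++ A, valid_cut C B A & w' = child n C B A].
Proof.
split=> [/allpairsPdep[[C D] [[B A] /= []]]|[C [B [A [-> v ->]]]]].
  rewrite mem_filter !mem_cuts /= => /eqP<- /andP[v /eqP<-] ->.
  by exists C, B, A.
apply/allpairsPdep; exists (C, B ++ A), (B, A).
by rewrite mem_filter !mem_cuts /= !eqxx v.
Qed.

(** The two copies of [n], absent from [w], mark the borders of [C], [B] and [A] in the child. *)
Lemma children_uniq n w : n \notin w -> uniq (children n w).
Proof.
move=> nw; apply: allpairs_uniq_dep => [|c _|].
- exact: cuts_uniq.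
- exact/filter_uniq/cuts_uniq.
move=> p1 p2 /allpairsPdep[[C D] [[B A] /= [+ + ->]]].
rewrite mem_filter !mem_cuts /= => /eqP defw /andP[_ /eqP /= defD].
rewrite -{}defD in defw *.
case/allpairsPdep=> [[C' D'] [[B' A'] /= [+ + ->]]].
rewrite mem_filter !mem_cuts /= => /eqP defw' /andP[_ /eqP /= defD'].
rewrite -{}defD' in defw' * => /=.
have := nw; rewrite -{1}defw !mem_cat !negb_or => /and3P[nC nB _].
have := nw; rewrite -{1}defw' !mem_cat !negb_or => /and3P[nC' nB' _].
case/(cat_cons_inj nC nC') => -> /(cat_cons_inj nB nB')[eB eA].
by rewrite eB eA.
Qed.

Lemma nn123_0 w : nn123 0 w <-> w = [::].
Proof.
split=> [[]|->]; last by split.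
by case: w => //= x w.
Qed.

Lemma mem_nn123_words n w : w \in nn123_words n <-> nn123 n w.
Proof.
elim: n w => [|n IHn] w /=; first by rewrite inE nn123_0; split=> [/eqP|->].
split=> [/allpairsPdep[w0 [w' [/IHn gw0 /mem_children[C [B [A [e v ->]]]] ->]]]|].
  by apply: nn123_child; rewrite -?e.
case/nn123_parent=> C [B [A [-> gw v]]]; apply/allpairsPdep.
exists (C ++ B ++ A), (child n C B A); split=> //; first exact/IHn.
by apply/mem_children; exists C, B, A.
Qed.

(** Erasing the largest label recovers the parent, so distinct parents have no common child. *)
Lemma nn123_words_uniq n : uniq (nn123_words n).
Proof.
elim: n => //= n IHn; apply: allpairs_uniq_dep => // [w|].
  by move/mem_nn123_words/nn123_notin; exact: children_uniq.
move=> p1 p2 /allpairsPdep[w [w' [/mem_nn123_words/nn123_notin nw + ->]]].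
case/mem_children=> C [B [A [e _ e']]].
case/allpairsPdep=> v [v' [/mem_nn123_words/nn123_notin nv + ->]] /= ev.
case/mem_children=> C1 [B1 [A1 [e1 _ e1']]].
suff -> : w = v by rewrite ev.
rewrite e e1 -(@filter_child n C) -?e // -(@filter_child n C1) -?e1 //.
by rewrite -e' -e1' ev.
Qed.

Lemma size_nn123_word n w : w \in nn123_words n -> size w = 2 * n.
Proof.
elim: n w => [|n IHn] w /=; first by rewrite inE => /eqP->.
case/allpairsPdep=> v [w' [/IHn sv /mem_children[C [B [A [e _ ->]]]] ->]].
by move: sv; rewrite e /child !size_cat /= size_cat /=; lia.
Qed.

Lemma sum_nn123_words n (phi : seq nat -> nat) :
  \sum_(w <- nn123_words n.+1) phi w = \sum_(w <- nn123_words n) child_sum n phi w.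
Proof.
rewrite /= big_allpairs_dep /=; apply: eq_bigr => w _.
rewrite /children /child_sum big_allpairs_dep; apply: eq_bigr => c _.
by rewrite big_filter.
Qed.

Fixpoint descendants m a k : nat :=
  if m is m'.+1 then succession_rule (descendants m') a k else 1.

Fixpoint word_descendants m n w : nat :=
  if m is m'.+1 then child_sum n (word_descendants m' n.+1) w else 1.

Lemma word_descendantsE m n w a k :
  state n w a k -> word_descendants m n w = descendants m a k.
Proof.
elim: m n w a k => //= m IHm n w a k; apply: child_sum_state; exact: IHm.
Qed.

(** Starting from an arbitrary generation [n] lets the induction run on [m]; the case [n = 0]
    reduces the count to the state [(0, 0)] of the empty word. *)
Lemma size_nn123_words_add m n :
  size (nn123_words (n + m)) = \sum_(w <- nn123_words n) word_descendants m n w.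
Proof.
elim: m n => [|m IHm] n; first by rewrite addn0 sum1_size.
by rewrite addnS -addSn IHm sum_nn123_words.
Qed.

Lemma size_nn123_words_descendants n : size (nn123_words n) = descendants n 0 0.
Proof.
rewrite -{1}[n]add0n size_nn123_words_add big_seq1; apply: word_descendantsE.
by exists [::], [::], [::]; split; split=> //; left.
Qed.

(** * From tuples to words *)

Section Words.
Variable n : nat.
Implicit Type w : (2 * n).-tuple 'I_n.

Definition word_of w : seq nat := [seq val a | a <- w].

Lemma nth_word_of w (i : 'I_(2 * n)) : nth 0 (word_of w) i = tnth w i.
Proof. by rewrite (nth_map (tnth w i)) ?size_tuple // -tnth_nth. Qed.

Lemma nonnestingP w : reflect
  (forall a b, a != b -> ~~ subseq [:: a; b; b; a] (word_of w)) (nonnesting w).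
Proof.
have szw : size (word_of w) = 2 * n by rewrite size_map size_tuple.
apply: (iffP idP) => [nw a b ab|nw].
  apply: contra nw => /(subseq_nthP 0)[I [sI aI eI]].
  move: eI; case: I sI aI => [|i [|j [|k [|l []]]]] //=; rewrite szw.
  case/and4P=> ij jk kl _ /and5P[li lj lk ll _] [ea eb eb' ea'].
  apply/existsP; exists (Ordinal li); apply/existsP; exists (Ordinal lj).
  apply/existsP; exists (Ordinal lk); apply/existsP; exists (Ordinal ll).
  rewrite ij jk kl -!val_eqE /= -!nth_word_of /=.
  by rewrite -ea -ea' -eb -eb' !eqxx.
apply/negP => /existsP[i] /existsP[j] /existsP[k] /existsP[l].
case/and5P=> ij jk kl /eqP il /andP[/eqP jl wij].
case/negP: (nw (tnth w i) (tnth w j) wij); apply/(subseq_nthP 0).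
exists [:: val i; val j; val k; val l]; rewrite szw /= ij jk kl !ltn_ord.
by rewrite !nth_word_of il jl.
Qed.

Lemma avoids123P w : reflect
  (forall x y z, x < y -> y < z -> ~~ subseq [:: x; y; z] (word_of w)) (avoids123 w).
Proof.
have szw : size (word_of w) = 2 * n by rewrite size_map size_tuple.
apply: (iffP idP) => [aw x y z xy yz|aw].
  apply: contra aw => /(subseq_nthP 0)[I [sI aI eI]].
  move: eI; case: I sI aI => [|i [|j [|k []]]] //=; rewrite szw.
  case/and3P=> ij jk _ /and4P[li lj lk _] [ex ey ez].
  apply/existsP; exists (Ordinal li); apply/existsP; exists (Ordinal lj).
  apply/existsP; exists (Ordinal lk).
  by apply/and4P; split=> //; rewrite -!nth_word_of /= -?ex -ey -?ez.
apply/negP => /existsP[i] /existsP[j] /existsP[k] /and4P[ij jk wij wjk].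
case/negP: (aw _ _ _ wij wjk); apply/(subseq_nthP 0).
exists [:: val i; val j; val k]; rewrite szw /= ij jk !ltn_ord.
by rewrite !nth_word_of.
Qed.

Lemma nn123_word_of w :
  nn123 n (word_of w) <-> [&& each_label_twice w, nonnesting w & avoids123 w].
Proof.
have cw (a : 'I_n) : count_mem (val a) (word_of w) = count_mem a w.
  by rewrite count_map; apply: eq_count => b /=; rewrite val_eqE.
split=> [[_ ew /nonnestingP-> /avoids123P->]|].
  by rewrite /= andbT; apply/forallP => a; rewrite -cw ew ?eqxx //; apply: ltn_ord.
case/and3P=> /forallP ew /nonnestingP nw /avoids123P aw; split=> //.
  by apply/allP => x /mapP[a _ ->]; exact: (ltn_ord a).
by move=> a an; rewrite -[a]/(val (Ordinal an)) cw; apply/eqP.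
Qed.

End Words.

Lemma c_nn123_words n : c_ n = size (nn123_words n).
Proof.
rewrite /c_ cardE -(size_map (@word_of n)).
apply/perm_size/uniq_perm => [||s].
- rewrite map_inj_uniq ?enum_uniq // => w v /inj_map eq_wv.
  by apply/val_inj/eq_wv/val_inj.
- exact: nn123_words_uniq.
apply/idP/idP => [/mapP[w + ->]|].
  by rewrite mem_enum inE => /nn123_word_of/mem_nn123_words.
move=> sgen; have szs := size_nn123_word sgen; have gs : nn123 n s by apply/mem_nn123_words.
pose t := pmap (insub : nat -> option 'I_n) s.
have et : map val t = s.
  rewrite /t (pmap_filter (insubK _)); apply/all_filterP/allP => x.
  by case: gs => /allP gs _ _ _ /gs /= xn; rewrite insubT.
have szt : size t == 2 * n by rewrite -szs -et size_map.
apply/mapP; exists (Tuple szt); last by rewrite /word_of /= et.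
by rewrite mem_enum inE; apply/nn123_word_of; rewrite /word_of /= et.
Qed.

(** * Reversal of words *)

Section Reversal.
Variable n : nat.
Implicit Type w : (2 * n).-tuple 'I_n.

Lemma tnth_rev w i : tnth [tuple of rev w] i = tnth w (rev_ord i).
Proof.
by set x := tnth w i; rewrite !(tnth_nth x) /= nth_rev size_tuple.
Qed.

Lemma rev_rev_tuple w : [tuple of rev [tuple of rev w]] = w.
Proof. by apply: val_inj; rewrite /= revK. Qed.

Lemma ltn_rev_ord m (i j : 'I_m) : (rev_ord i < rev_ord j) = (j < i).
Proof. by rewrite /=; have := ltn_ord i; have := ltn_ord j; lia. Qed.

Lemma nonnesting_rev w : nonnesting [tuple of rev w] = nonnesting w.
Proof.
suff imp (v : (2 * n).-tuple 'I_n) : nonnesting v -> nonnesting [tuple of rev v].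
  by apply/idP/idP => /imp //; rewrite rev_rev_tuple.
rewrite /nonnesting; apply: contra => /existsP[i] /existsP[j] /existsP[k] /existsP[l].
rewrite !tnth_rev => /and5P[ij jk kl il /andP[jk' ij']].
apply/existsP; exists (rev_ord l); apply/existsP; exists (rev_ord k).
apply/existsP; exists (rev_ord j); apply/existsP; exists (rev_ord i).
rewrite !ltn_rev_ord ij jk kl eq_sym il eq_sym jk' /=.
by rewrite -(eqP il) -(eqP jk').
Qed.

Lemma avoids321_rev w : avoids321 [tuple of rev w] = avoids123 w.
Proof.
congr (~~ _); apply/existsP/existsP => -[i /existsP[j /existsP[k]]].
  rewrite !tnth_rev => /and4P[ij jk wij wjk].
  exists (rev_ord k); apply/existsP; exists (rev_ord j); apply/existsP.
  by exists (rev_ord i); rewrite !ltn_rev_ord ij jk wij wjk.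
case/and4P=> ij jk wij wjk.
exists (rev_ord k); apply/existsP; exists (rev_ord j); apply/existsP.
by exists (rev_ord i); rewrite !tnth_rev !rev_ordK !ltn_rev_ord ij jk wij wjk.
Qed.

Lemma each_label_twice_rev w : each_label_twice [tuple of rev w] = each_label_twice w.
Proof. by apply: eq_forallb => a; rewrite count_rev. Qed.

End Reversal.

Lemma d_eq_c n : d_ n = c_ n.
Proof.
pose f (w : (2 * n).-tuple 'I_n) := [tuple of rev w].
have inj_f : injective f by apply: (@can_inj _ _ f f) => w; apply: rev_rev_tuple.
rewrite /d_ /c_ -[in RHS](card_imset _ inj_f); apply: eq_card => w.
have -> : w = f (f w) by rewrite /f rev_rev_tuple.
rewrite mem_imset // !inE /f each_label_twice_rev nonnesting_rev.
by rewrite avoids321_rev.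
Qed.

Lemma c_descendants n : c_ n = descendants n 0 0.
Proof. by rewrite c_nn123_words size_nn123_words_descendants. Qed.

(** * Formal power series *)

Local Open Scope ring_scope.

Section Fps.
Variable F : fieldType.
Implicit Types f g h : fps F.

Definition fpsX : fps F := fps_of_poly 'X.

Lemma fcoefD f g n : fcoef (f + g) n = fcoef f n + fcoef g n.
Proof. by []. Qed.

Lemma fcoefB f g n : fcoef (f - g) n = fcoef f n - fcoef g n.
Proof. by []. Qed.

Lemma fcoefM f g n : fcoef (f * g) n = \sum_(i < n.+1) fcoef f i * fcoef g (n - i).
Proof. by []. Qed.

Lemma fcoef1 n : fcoef (1 : fps F) n = (n == 0%N)%:R.
Proof. by []. Qed.

Lemma fcoef_sum I (r : seq I) (P : pred I) (G : I -> fps F) n :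
  fcoef (\sum_(i <- r | P i) G i) n = \sum_(i <- r | P i) fcoef (G i) n.
Proof. by apply: (big_morph (fun f => fcoef f n)). Qed.

Lemma fcoefMn f m n : fcoef (f *+ m) n = fcoef f n *+ m.
Proof. by elim: m => // m IHm; rewrite !mulrS fcoefD IHm. Qed.

Lemma fcoefXM0 f : fcoef (fpsX * f) 0 = 0.
Proof. by rewrite fcoefM big_ord1 /= coefX mul0r. Qed.

Lemma fcoefXMS f n : fcoef (fpsX * f) n.+1 = fcoef f n.
Proof.
rewrite fcoefM !big_ord_recl big1 ?addr0 => [|i _]; last by rewrite /= coefX mul0r.
by rewrite /= !coefX mul0r mul1r add0r subn1.
Qed.

Definition fps_agree n f g := forall i, (i < n)%N -> fcoef f i = fcoef g i.

Lemma fps_agreeM n f f' g g' :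
  fps_agree n f f' -> fps_agree n g g' -> fps_agree n (f * g) (f' * g').
Proof.
move=> ff' gg' i ltin; rewrite !fcoefM; apply: eq_bigr => j _.
rewrite ff' ?gg' //; first exact: leq_ltn_trans (leq_subr _ _) ltin.
by apply: leq_ltn_trans ltin; rewrite -ltnS.
Qed.

Lemma fps_agreeD n f f' g g' :
  fps_agree n f f' -> fps_agree n g g' -> fps_agree n (f + g) (f' + g').
Proof. by move=> ff' gg' i ltin; rewrite !fcoefD ff' ?gg'. Qed.

Lemma fps_agreeXM n f g : fps_agree n f g -> fps_agree n.+1 (fpsX * f) (fpsX * g).
Proof. by move=> fg [|i] ltin; rewrite ?fcoefXM0 // !fcoefXMS fg. Qed.

(** Gaining one coefficient of agreement per application makes [T] a contraction in the [z]-adic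
    sense; coefficient [n] is final after [n + 1] iterations. *)
Lemma fps_fixpoint (T : fps F -> fps F) :
  (forall n f g, fps_agree n f g -> fps_agree n.+1 (T f) (T g)) ->
  exists f, f = T f.
Proof.
move=> contrT; exists (FPS (fun n => fcoef (iter n.+1 T 0) n)).
have agree_iter n m f g : (n <= m)%N -> fps_agree n (iter m T f) (iter m T g).
  elim: n m => [|n IHn] [|m] //= /IHn; exact: contrT.
apply: fpsP => n; apply: (contrT n) => // i ltin.
change (fcoef (iter n T 0) i = fcoef (iter i.+1 T 0) i).
have -> : n = (i.+1 + (n - i.+1))%N by rewrite subnKC.
by rewrite iterD; apply: (agree_iter i.+1).
Qed.

Lemma fps_catalan : exists K, K = 1 + fpsX * K ^+ 2.
Proof.
apply: fps_fixpoint => n f g fg; apply: fps_agreeD => //.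
by apply: fps_agreeXM; rewrite !expr2; apply: fps_agreeM.
Qed.

Lemma fps_motzkin : exists y, y = fpsX * (1 + y + y ^+ 2) *+ 2.
Proof.
apply: fps_fixpoint => n f g fg; rewrite !mulr2n.
by apply: fps_agreeD; apply: fps_agreeXM; rewrite !expr2;
  apply: fps_agreeD; rewrite ?expr2; do ?[exact: fps_agreeM | exact: fps_agreeD].
Qed.

(** The explicit factor [z] makes the map contracting. In the application [z g = y (K^2 - 1)], where
    the factor comes from the equation of [y]. *)
Lemma fps_geometric g : exists B, B = 1 + fpsX * g * B.
Proof.
apply: fps_fixpoint => n f f' ff'; apply: fps_agreeD => //.
by rewrite -!mulrA; apply/fps_agreeXM/fps_agreeM.
Qed.

(** Because of the factor [z], coefficient [m + 1] of each unknown depends only on coefficients [m]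
    of the others, so the infinite system has at most one solution. *)
Lemma descendants_fps (Phi : nat -> nat -> fps F) :
    (forall a k, Phi a k = 1 + fpsX * succession_rule Phi a k) ->
  forall m a k, fcoef (Phi a k) m = (descendants m a k)%:R.
Proof.
have natrMn (x m : nat) : (x *+ m)%:R = x%:R *+ m :> F.
  by elim: m => // m IHm; rewrite !mulrS natrD IHm.
move=> eqPhi; elim=> [|m IHm] a k; rewrite eqPhi fcoefD fcoef1.
  by rewrite fcoefXM0 addr0.
rewrite fcoefXMS add0r /= /succession_rule; case: k => [|k].
  rewrite fcoefD IHm fcoef_sum natrD; congr (_ + _).
  by rewrite natr_sum; apply: eq_bigr => q _; exact: IHm.
rewrite !(fcoefD, fcoefMn) fcoef_sum !IHm !natrD !natrMn natr_sum.
congr (_ + _ *+ 2 + _); last by rewrite natrD.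
by apply: eq_bigr => q _; rewrite fcoefD !IHm natrD.
Qed.

(** * Closed form of the succession system *)

Section Solution.
Variables K y B : fps F.
Hypothesis eqK : K = 1 + fpsX * K ^+ 2.
Hypothesis eqy : y = fpsX * (1 + y + y ^+ 2) *+ 2.
Hypothesis eqB : B = 1 + y * (K ^+ 2 - 1) * B.

(* For [k = 0] the solution is, up to a constant, geometric in [a] with ratio the
   root [K] of [z x^2 - x + 1]; for [k > 0] it is affine in [a] and geometric in
   [k] with ratio the root [1 + 2y] of [z x^2 - x + 1 + 3z]. *)
Definition succession_solution a k : fps F :=
  if k is k'.+1 then (1 + y *+ 2) ^+ k' * K ^+ 2 * B * (1 + y + y *+ a)
  else K ^+ a.+1 * B * (1 + y) - y * K ^+ 2 * B.

(** At [j = 0] the two summands come from different branches of the solution, yet their sum fits the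
    same geometric law; so the sums in the rule need no separate first term. *)
Lemma succession_solution_pair j :
  succession_solution 0 j.+1 + succession_solution 1 j =
    (1 + y *+ 2) ^+ j * K ^+ 2 * B * (2 + y).
Proof. by case: j => [|j] /=; rewrite ?exprS; ring. Qed.

Lemma succession_solutionP a k :
  succession_solution a k = 1 + fpsX * succession_rule succession_solution a k.
Proof.
(* Each identity below is exhibited as a combination of these three vanishing expressions with
   explicit cofactors, which [ring] then checks. *)
have eK : K - (1 + fpsX * K ^+ 2) = 0 by rewrite -eqK subrr.
have ey : y - fpsX * (1 + y + y ^+ 2) *+ 2 = 0 by rewrite -eqy subrr.
have eB : B - (1 + y * (K ^+ 2 - 1) * B) = 0 by rewrite -eqB subrr.
case: k => [|k].
  elim: a => [|a IHa]; apply/subr0_eq.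
    rewrite /= big_ord0.
    transitivity (B - (1 + y * (K ^+ 2 - 1) * B)
      + B * (1 + y) * (K - (1 + fpsX * K ^+ 2))); first by ring.
    by rewrite eB eK mulr0 addr0.
  (* Subtracting the equations for [a] and [a + 1] telescopes the sum. The constant [- y K^2 B]
     cancels the slope in [a] of the [k = 1] value, and [z K^2 = K - 1] remains. *)
  rewrite /succession_rule big_ord_recr.
  have -> : succession_solution a.+1 0 = succession_solution a 0
      + (K - 1) * K ^+ a.+1 * B * (1 + y) by rewrite /= !exprS; ring.
  rewrite IHa /= /succession_rule.
  transitivity (K ^+ a.+1 * B * (1 + y) * (K - (1 + fpsX * K ^+ 2))).
    rewrite /= !exprS; ring.
  by rewrite eK mulr0.
elim: k => [|k IHk]; apply/subr0_eq.
  rewrite /succession_rule big_ord0 succession_solution_pair /=.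
  transitivity ((B - (1 + y * (K ^+ 2 - 1) * B))
      + (K + 1) * B * (1 + y) * (K - (1 + fpsX * K ^+ 2))
      + (y - fpsX * (1 + y + y ^+ 2) *+ 2) * K ^+ 2 * B *+ a.+1); first by ring.
  by rewrite eB eK ey !(mulr0, mul0r, mul0rn, addr0).
have -> : succession_solution a k.+2 = succession_solution a k.+1
    + (1 + y *+ 2) ^+ k * K ^+ 2 * B * (1 + y + y *+ a) * y *+ 2 by rewrite /= !exprS; ring.
rewrite IHk /succession_rule big_ord_recr !succession_solution_pair /=.
transitivity ((1 + y *+ 2) ^+ k * K ^+ 2 * B * (1 + y + y *+ a)
   * (y - fpsX * (1 + y + y ^+ 2) *+ 2) *+ 2); last by rewrite ey mulr0 mul0rn.
rewrite !exprS; ring.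
Qed.

Lemma fcoef_solution_c n : fcoef (succession_solution 0 0) n = (c_ n)%:R.
Proof.
by rewrite c_descendants; apply: descendants_fps => a k; exact: succession_solutionP.
Qed.

End Solution.

End Fps.

(** * Biquadratic extensions *)

Section Biquadratic.
Variables (F E : fieldType) (h : {rmorphism F -> E}) (A B : F).
Hypotheses (two_neq0 : (2 : F) != 0) (nsqA : forall x, x ^+ 2 != A)
  (nsqB : forall x, x ^+ 2 != B) (nsqAB : forall x, x ^+ 2 != A * B).

Definition biquad (al be : E) (a b c d : F) : E :=
  h a + h b * al + (h c + h d * al) * be.

Section Independence.
Variables al be : E.
Hypotheses (al2 : al ^+ 2 = h A) (be2 : be ^+ 2 = h B).

Lemma quad_free a b : h a + h b * al = 0 -> a = 0 /\ b = 0.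
Proof.
have [-> | b0 eq0] := eqVneq b 0.
  by rewrite rmorph0 mul0r addr0 => /eqP; rewrite fmorph_eq0 => /eqP.
case/negP: (nsqA (- a / b)); apply/eqP/(fmorph_inj h).
rewrite -al2; have -> : al = h (- a / b).
  rewrite fmorph_div rmorphN; apply: (mulfI (_ : h b != 0)); first by rewrite fmorph_eq0.
  by rewrite mulrCA divff ?fmorph_eq0 // mulr1; apply/eqP; rewrite -addr_eq0 addrC eq0.
by rewrite rmorphXn.
Qed.

(** If the coefficient of [be] were nonzero, dividing by it would give [be = x + y al]. Squaring and
    using the independence of [1] and [al] yields [x y = 0], so that [B] or [A B] would be a
    square. *)
Lemma biquad_free a b c d :
  biquad al be a b c d = 0 -> [/\ a = 0, b = 0, c = 0 & d = 0].
Proof.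
rewrite /biquad => eq0.
have [v0|v0] := eqVneq (h c + h d * al) 0.
  have [-> ->] := quad_free v0.
  by move: eq0; rewrite v0 mul0r addr0 => /quad_free[-> ->].
pose N := c ^+ 2 - d ^+ 2 * A.
have N0 : N != 0.
  apply: contra v0; rewrite subr_eq0 => /eqP eqN.
  have [d0|d0] := eqVneq d 0.
    move: eqN; rewrite d0 expr0n mul0r => /eqP; rewrite expf_eq0 => /andP[_ /eqP->].
    by rewrite rmorph0 mul0r addr0.
  case/negP: (nsqA (c / d)); rewrite expr_div_n eqN mulrAC divff ?mul1r //.
  by rewrite expf_neq0.
pose x := - (a * c - b * d * A) / N; pose y := - (b * c - a * d) / N.
have be_xy : be = h x + h y * al.
  apply: (mulfI (_ : h N != 0)); first by rewrite fmorph_eq0.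
  have -> : h N * (h x + h y * al) = h (N * x) + h (N * y) * al by rewrite !rmorphM; ring.
  rewrite [N * x]mulrC [N * y]mulrC !divfK //.
  apply/subr0_eq; rewrite /N !(rmorphB, rmorphM, rmorphN, rmorphXn) /= -al2.
  transitivity ((h c - h d * al) * (h a + h b * al + (h c + h d * al) * be)); first by ring.
  by rewrite eq0 mulr0.
clearbody x y.
have : h (x ^+ 2 + y ^+ 2 * A - B) + h (x * y *+ 2) * al = 0.
  rewrite !(rmorphB, rmorphD, rmorphM, rmorphMn, rmorphXn) /= -al2 -be2 be_xy; ring.
case/quad_free=> /subr0_eq eqB /eqP.
rewrite -mulr_natr !mulf_eq0 (negPf two_neq0) orbF => /orP[/eqP x0|/eqP y0].
  case/negP: (nsqAB (y * A)); rewrite -eqB x0; apply/eqP; ring.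
by case/negP: (nsqB x); rewrite -eqB y0; apply/eqP; ring.
Qed.

End Independence.

Variables a b c d : F.

(** The coordinates are chosen before [al] and [be], hence serve all four sign choices at once; this
    replaces the action of a Galois group. *)
Lemma horner_biquad (p : {poly F}) : exists a' b' c' d', forall al be,
  al ^+ 2 = h A -> be ^+ 2 = h B ->
  (map_poly h p).[biquad al be a b c d] = biquad al be a' b' c' d'.
Proof.
elim/poly_ind: p => [|p e [a' [b' [c' [d' IHp]]]]].
  exists 0, 0, 0, 0 => al be _ _.
  by rewrite /biquad map_poly0 horner0 !rmorph0 !(mul0r, addr0).
exists (a' * a + b' * b * A + c' * c * B + d' * d * A * B + e),
  (a' * b + b' * a + c' * d * B + d' * c * B),
  (a' * c + c' * a + (b' * d + d' * b) * A), (a' * d + d' * a + b' * c + c' * b).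
move=> al be al2 be2; rewrite rmorphD rmorphM /= map_polyX map_polyC /=.
rewrite hornerMXaddC IHp // /biquad !(rmorphD, rmorphM) /= -al2 -be2; ring.
Qed.

Lemma biquad_degree al be : al ^+ 2 = h A -> be ^+ 2 = h B -> c != 0 -> d != 0 ->
  algebraic_degree h (biquad al be a b c d) 4.
Proof.
move=> al2 be2 c0 d0; split.
  (* Expanding [(v - b al)^2 = (c + d al)^2 B] and collecting [al] gives [p0 = al p1]; squaring
     eliminates [al]. *)
  pose v := 'X - a%:P.
  pose p0 := v ^+ 2 + (b ^+ 2 * A - (c ^+ 2 + d ^+ 2 * A) * B)%:P.
  pose p1 := (b *+ 2) *: v + (c * d * B *+ 2)%:P.
  exists (p0 ^+ 2 - A *: p1 ^+ 2).
  have sz0 : size p0 = 3.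
    rewrite /p0 size_addl ?size_exp_XsubC //.
    by rewrite (leq_ltn_trans (size_polyC_leq1 _)).
  have sz1 : (size p1 <= 2)%N.
    rewrite (leq_trans (size_polyD _ _)) // geq_max.
    rewrite (leq_trans (size_scale_leq _ _)) ?size_XsubC //.
    by rewrite (leq_trans (size_polyC_leq1 _)).
  have sz : size (p0 ^+ 2 - A *: p1 ^+ 2) = 5.
    have sz02 : size (p0 ^+ 2) = 5.
      by rewrite expr2 size_mul -?size_poly_eq0 ?sz0.
    rewrite size_addl // sz02 size_opp (leq_ltn_trans (size_scale_leq _ _)) //.
    rewrite expr2 (leq_ltn_trans (size_polyMleq _ _)) //.
    by case: (size p1) sz1 => [|[|[|]]].
  split=> //; first by rewrite -size_poly_eq0 sz.
  rewrite /root !(rmorphB, rmorphD, rmorphXn) /= !map_polyZ /= !rmorphXn /=.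
  rewrite /p0 /p1 /v !(rmorphB, rmorphD, rmorphXn) /= !map_polyZ /= rmorphB /=.
  rewrite !map_polyX !map_polyC /=.
  rewrite !hornerE /biquad.
  rewrite !(rmorphB, rmorphD, rmorphM, rmorphMn, rmorphXn) /= -al2 -be2.
  apply/eqP; ring.
move=> p p0; have [a' [b' [c' [d' ev]]]] := horner_biquad p.
rewrite /root ev // => /eqP/(biquad_free al2 be2)[ea eb ec ed].
(* [p] also vanishes at the conjugates obtained by sign changes of [al] and [be]. *)
have root_p s t : s ^+ 2 = 1 -> t ^+ 2 = 1 ->
    root (map_poly h p) (biquad (s * al) (t * be) a b c d).
  move=> s2 t2; rewrite /root ev ?exprMn ?s2 ?t2 ?mul1r //.
  by rewrite ea eb ec ed /biquad !rmorph0 !(mul0r, addr0).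
pose rs := [seq biquad (st.1 * al) (st.2 * be) a b c d |
  st <- [:: (1, 1); (1, -1); (-1, 1); (-1, -1)]].
rewrite -(size_map_poly h) -[4%N]/(size rs); apply: max_poly_roots.
- by rewrite map_poly_eq0.
- by rewrite /= !root_p // ?sqrrN expr1n.
(* Any two of the four values differ by an element whose [be] or [al be] coordinate is [2c] or [2d]
   up to sign. *)
have neq b1 c1 d1 x y : ~~ [&& b1 == 0, c1 == 0 & d1 == 0] ->
    x - y = biquad al be 0 b1 c1 d1 -> x != y.
  move=> nz exy; apply: contraNneq nz => eq_xy.
  move: exy; rewrite eq_xy subrr => /esym/(biquad_free al2 be2)[_ -> -> ->].
  by rewrite !eqxx.
have nz2 (x : F) : (x *+ 2 == 0) = (x == 0).
  by rewrite -mulr_natr mulf_eq0 (negPf two_neq0) orbF.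
rewrite /= !inE !negb_or !andbT; apply/and3P; split; [apply/and3P; split | apply/andP; split|].
- apply: (neq 0 (c *+ 2) (d *+ 2)); first by rewrite ?nz2 ?(negPf c0) ?andbF.
  by rewrite /biquad !rmorphMn rmorph0 /=; ring.
- apply: (neq (b *+ 2) 0 (d *+ 2)); first by rewrite ?nz2 ?(negPf d0) ?andbF.
  by rewrite /biquad !rmorphMn rmorph0 /=; ring.
- apply: (neq (b *+ 2) (c *+ 2) 0); first by rewrite ?nz2 ?(negPf c0) ?andbF.
  by rewrite /biquad !rmorphMn rmorph0 /=; ring.
- apply: (neq (b *+ 2) (- c *+ 2) 0); first by rewrite ?nz2 ?oppr_eq0 ?(negPf c0) ?andbF.
  by rewrite /biquad !rmorphMn !rmorphN rmorph0 /=; ring.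
- apply: (neq (b *+ 2) 0 (- d *+ 2)); first by rewrite ?nz2 ?oppr_eq0 ?(negPf d0) ?andbF.
  by rewrite /biquad !rmorphMn ?rmorphN rmorph0 /=; ring.
- apply: (neq 0 (c *+ 2) (- d *+ 2)); first by rewrite ?nz2 ?oppr_eq0 ?(negPf c0) ?andbF.
  by rewrite /biquad !rmorphMn ?rmorphN rmorph0 /=; ring.
Qed.

End Biquadratic.

(** After clearing denominators, the simple root [r] would have even multiplicity on one side and
    odd multiplicity on the other. *)
Lemma ratfun_nonsquare (F : fieldType) (p q : {poly F}) (r : F) :
  p = ('X - r%:P) * q -> ~~ root q r -> forall x : {fraction {poly F}}, x ^+ 2 != p%:F.
Proof.
move=> -> qr x; rewrite [x]ratfun_numden.
set n := \n_(repr x); set d := \d_(repr x).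
have d0 : d != 0 by exact: denom_ratioP.
apply/eqP => eqx.
have : n ^+ 2 = ('X - r%:P) * q * d ^+ 2.
  have := congr1 (fun t => t * d%:F ^+ 2) eqx.
  rewrite expr_div_n divfK ?expf_neq0 ?tofrac_eq0 // -!rmorphXn -rmorphM.
  by move/eqP; rewrite tofrac_eq => /eqP.
have [->|n0] := eqVneq n 0.
  move/eqP; rewrite expr0n eq_sym !mulf_eq0 polyXsubC_eq0 (negPf d0) !orbF /=.
  by move/eqP=> q0; rewrite q0 root0 in qr.
have q0 : q != 0 by apply: contraNneq qr => ->; exact: root0.
move/(congr1 (mup r)); rewrite !expr2 !mupM ?mulf_neq0 ?polyXsubC_eq0 //.
have -> : mup r ('X - r%:P) = 1%N by rewrite -['X - _]expr1 mup_XsubCX eqxx.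
rewrite (mupNroot qr) => /(congr1 odd).
by rewrite !oddD !addbb.
Qed.

Lemma laurent_of_ratfun_poly (F : fieldType) (p : {poly F}) :
  laurent_of_ratfun p%:F = (fps_of_poly p)%:F.
Proof.
have -> : p%:F = p%:F / 1%:F :> {fraction {poly F}} by rewrite rmorph1 divr1.
by rewrite laurent_of_ratfunE ?oner_neq0 // !rmorph1 divr1.
Qed.

Lemma biquad_scale (E : fieldType) (D a b c d al be : E) : D != 0 ->
  a + b * al + (c + d * al) * be =
  D * (a / D + b / D * al + (c / D + d / D * al) * be).
Proof. by move=> D0; field. Qed.

Section DegreeFps.
Variables (A B D a b c d : {poly rat}) (al be u : fps rat).
Hypotheses (nsqA : forall x : {fraction {poly rat}}, x ^+ 2 != A%:F)
  (nsqB : forall x : {fraction {poly rat}}, x ^+ 2 != B%:F)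
  (nsqAB : forall x : {fraction {poly rat}}, x ^+ 2 != (A * B)%:F)
  (al2 : al ^+ 2 = fps_of_poly A) (be2 : be ^+ 2 = fps_of_poly B)
  (D0 : D != 0) (c0 : c != 0) (d0 : d != 0)
  (eq_u : fps_of_poly D * u = fps_of_poly a + fps_of_poly b * al
     + (fps_of_poly c + fps_of_poly d * al) * be).

Lemma biquad_degree_fps : algebraic_degree (@laurent_of_ratfun rat) u%:F 4.
Proof.
have -> : u%:F = biquad (@laurent_of_ratfun rat) al%:F be%:F
   (a%:F / D%:F) (b%:F / D%:F) (c%:F / D%:F) (d%:F / D%:F).
  rewrite /biquad !fmorph_div /= !laurent_of_ratfun_poly.
  have Df0 : (fps_of_poly D)%:F != 0 :> {fraction (fps rat)}.
    by rewrite fps_of_poly_fracr_eq0.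
  apply: (mulfI Df0); rewrite -rmorphM eq_u !(rmorphD, rmorphM) /=.
  exact: biquad_scale.
have two0 : (2 : {fraction {poly rat}}) != 0.
  by rewrite -(rmorph_nat (@FracField.tofrac _)) tofrac_eq0 -polyC_natr polyC_eq0.
have al2' : al%:F ^+ 2 = laurent_of_ratfun A%:F.
  by rewrite laurent_of_ratfun_poly -rmorphXn /= al2.
have be2' : be%:F ^+ 2 = laurent_of_ratfun B%:F.
  by rewrite laurent_of_ratfun_poly -rmorphXn /= be2.
have div0 (p : {poly rat}) : p != 0 -> p%:F / D%:F != 0 :> {fraction {poly rat}}.
  by move=> p0; apply: mulf_neq0; rewrite ?invr_eq0 tofrac_eq0.
have nsqAB' (x : {fraction {poly rat}}) : x ^+ 2 != A%:F * B%:F.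
  by rewrite -rmorphM; exact: nsqAB.
exact: (biquad_degree two0 nsqA nsqB nsqAB' _ _ al2' be2' (div0 c c0) (div0 d d0)).
Qed.

End DegreeFps.

(** * The algebraic degree *)

Section ExplicitBiquadratic.
Variables (F : fieldType) (K y B : fps F).
Hypotheses (eqK : K = 1 + fpsX F * K ^+ 2)
  (eqy : y = fpsX F * (1 + y + y ^+ 2) *+ 2)
  (eqB : B = 1 + y * (K ^+ 2 - 1) * B).
Local Notation z := (fpsX F).

(** The quadratic formula read backwards: the roots of the two discriminants are expressed through
    [K] and [y], so that no square root of a series has to be constructed. *)
Definition sqrt_catalan := 1 - z * K *+ 2.
Definition sqrt_motzkin := 1 - z *+ 2 - z * y *+ 4.
Local Notation al := sqrt_catalan.
Local Notation be := sqrt_motzkin.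

Lemma XK2 : z * K ^+ 2 = K - 1.
Proof. by rewrite [in RHS]eqK addrC addKr. Qed.

Lemma sqrt_catalan2 : al ^+ 2 = 1 - z *+ 4.
Proof.
rewrite /al; transitivity (1 - z * K *+ 4 + z * (z * K ^+ 2) *+ 4); first by ring.
by rewrite XK2; ring.
Qed.

Lemma sqrt_motzkin2 : be ^+ 2 = (1 - z *+ 6) * (1 + z *+ 2).
Proof.
apply/subr0_eq; rewrite /be.
transitivity (- z * (y - z * (1 + y + y ^+ 2) *+ 2) *+ 8); first by ring.
by rewrite -eqy subrr mulr0 mul0rn.
Qed.

(* Eliminating [y] gives [C - 1 = 2(1 + 2z)(K - 1)/Q] with
   [Q = 2(1 + 2z) - K^2(1 + 2z - beta)]; multiplying by the conjugates
   under [beta -> -beta] and then [alpha -> -alpha] clears the denominator. *)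
Section Coefficients.
Variable R : comNzRingType.
Variable x : R.
Definition den0 := x ^+ 4 *+ 4 + x ^+ 3 *+ 6 + x ^+ 2 *+ 4 - x *+ 9 + 2.
Definition den1 := 2 - x *+ 5 - x ^+ 2 *+ 2.
Definition num0 := (1 + x *+ 2) * (x ^+ 2 * (1 - x *+ 2) *+ 2 - (1 - x *+ 4 + x ^+ 2 *+ 2)).
Definition num1 := (1 + x *+ 2) * (1 - x *+ 2 - x ^+ 2 *+ 2).
Definition num2 := - (1 - x *+ 4 + x ^+ 2 *+ 2).
Definition num3 := 1 - x *+ 2.
Definition coef_den := (den0 ^+ 2 - den1 ^+ 2 * (1 - x *+ 4)) *+ 2.
Definition coef_a := coef_den + (num0 * den0 + num1 * den1 * (1 - x *+ 4)).
Definition coef_b := num0 * den1 + num1 * den0.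
Definition coef_c := num2 * den0 + num3 * den1 * (1 - x *+ 4).
Definition coef_d := num2 * den1 + num3 * den0.
End Coefficients.

Lemma rmorph_coefs (R S : comNzRingType) (f : {rmorphism R -> S}) x :
  [/\ f (coef_den x) = coef_den (f x), f (coef_a x) = coef_a (f x),
      f (coef_b x) = coef_b (f x), f (coef_c x) = coef_c (f x) &
      f (coef_d x) = coef_d (f x)].
Proof.
rewrite /coef_a /coef_b /coef_c /coef_d /coef_den /num0 /num1 /num2 /num3 /den0 /den1.
by split; rewrite !(rmorphD, rmorphN, rmorphB, rmorphM, rmorphMn, rmorphXn, rmorph1,
  rmorph_nat).
Qed.

Lemma solution_biquad (C := succession_solution K y B 0 0) : (2 : F) != 0 ->
  coef_den z * C = coef_a z + coef_b z * al + (coef_c z + coef_d z * al) * be.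
Proof.
move=> two_neq0.
have two_fps : (2 : fps F) != 0.
  apply: contra two_neq0 => /eqP /(congr1 (fun f => fcoef f 0)).
  by rewrite fcoefMn fcoef1 => /eqP.
have ey : y - z * (1 + y + y ^+ 2) *+ 2 = 0 by rewrite -eqy subrr.
have eB : B - (1 + y * (K ^+ 2 - 1) * B) = 0 by rewrite -eqB subrr.
have y0 : fcoef y 0 = 0 by rewrite eqy fcoefMn fcoefXM0 mul0rn.
have neq0 f : fcoef f 0 = 1 -> f != 0 :> fps F.
  by move=> f0; apply/eqP => fz; move/eqP: f0; rewrite fz eq_sym oner_eq0.
have eK : K - (1 + z * K ^+ 2) = 0 by rewrite -eqK subrr.
(* [W] is the inverse of [B]. *)
pose W := 1 + y - y * K ^+ 2.
have CW : W * (C - 1) = (K - 1) * (1 + y).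
  apply/subr0_eq; rewrite /C /= expr1 /W.
  transitivity ((1 + y - y * K ^+ 2) * B * K * (1 + y)
     - (1 + y - y * K ^+ 2) * B * (y * K ^+ 2) - (1 + y - y * K ^+ 2) - (K - 1) * (1 + y)).
    by ring.
  have -> : (1 + y - y * K ^+ 2) * B = 1.
    apply/subr0_eq; rewrite -eB; ring.
  ring.
pose Q := (1 + z *+ 2) *+ 2 - K ^+ 2 * (1 + z *+ 2 - be).
have WQ : (1 + z *+ 2) * W *+ 2 = (1 + y) * Q.
  apply/subr0_eq; rewrite /W /Q /be.
  transitivity (- K ^+ 2 * (y - z * (1 + y + y ^+ 2) *+ 2) *+ 2); first by ring.
  by rewrite ey mulr0 mul0rn.
have QC : Q * (C - 1) = (1 + z *+ 2) * (K - 1) *+ 2.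
  apply: (mulfI (neq0 (1 + y) _)); first by rewrite fcoefD y0 addr0.
  rewrite mulrA -WQ; transitivity ((1 + z *+ 2) * (W * (C - 1)) *+ 2); first by ring.
  by rewrite CW; ring.
pose Q' := (1 + z *+ 2) *+ 2 - K ^+ 2 * (1 + z *+ 2 + be).
(* [D'] is linear in [K]: the higher powers in [z^2 Q Q'] are lowered by [z K^2 = K - 1]. *)
pose D' := K * den1 z + (z ^+ 3 *+ 2 + z ^+ 2 *+ 3 + z *+ 3 - 2).
have QQ' : z ^+ 2 * (Q * Q') = (1 + z *+ 2) * D' *+ 4.
  transitivity ((1 + z *+ 2) * (z ^+ 2 * (1 + z *+ 2) *+ 4
    - (1 + z *+ 2) * z * (z * K ^+ 2) *+ 4 + (z * K ^+ 2) ^+ 2 * z *+ 8)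
    + K ^+ 4 * z ^+ 2 * ((1 - z *+ 6) * (1 + z *+ 2) - be ^+ 2)).
    by rewrite /Q /Q'; ring.
  rewrite XK2 sqrt_motzkin2 subrr mulr0 addr0.
  apply/subr0_eq.
  transitivity ((1 + z *+ 2) * (z * K ^+ 2 - (K - 1)) *+ 8).
    by rewrite /D' /den1; ring.
  by rewrite XK2 subrr mulr0 mul0rn.
have D'e : z * D' *+ 2 = den0 z - den1 z * al by rewrite /D' /den0 /den1 /al; ring.
have num : z ^+ 3 * ((K - 1) * Q') *+ 2 =
    num0 z + num1 z * al + (num2 z + num3 z * al) * be.
  apply/subr0_eq.
  transitivity ((z * K ^+ 2 - (K - 1)) * (z ^+ 2 * (K - 1) + z)
    * (- (1 + z *+ 2 + be)) *+ 2).
    by rewrite /Q' /num0 /num1 /num2 /num3 /al; ring.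
  by rewrite XK2 subrr !mul0r mul0rn.
apply: (mulfI two_fps); apply: (mulfI (neq0 (1 + z *+ 2) _)).
  by rewrite fcoefD fcoefMn fcoef1 /= coefX mul0rn addr0.
apply/subr0_eq.
transitivity ((1 + z *+ 2) *+ 2 * (coef_den z * (C - 1)
  - (num0 z + num1 z * al + (num2 z + num3 z * al) * be) * (den0 z + den1 z * al)
  + (num1 z + num3 z * be) * den1 z * (al ^+ 2 - (1 - z *+ 4)))).
  by rewrite /coef_a /coef_b /coef_c /coef_d; ring.
rewrite sqrt_catalan2 subrr mulr0 addr0 -num.
have -> : coef_den z = (den0 z - den1 z * al) * (den0 z + den1 z * al) *+ 2
    + den1 z ^+ 2 * (al ^+ 2 - (1 - z *+ 4)) *+ 2 by rewrite /coef_den; ring.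
rewrite sqrt_catalan2 subrr mulr0 mul0rn addr0 -D'e.
transitivity (z * (den0 z + den1 z * al) *+ 2 * ((1 + z *+ 2) * D' *+ 4 * (C - 1)
   - z ^+ 2 * Q' * ((1 + z *+ 2) * (K - 1) *+ 2))); first by ring.
by rewrite -QQ' -QC; ring.
Qed.
End ExplicitBiquadratic.

Lemma gen_fun_c (K y B : fps rat) : K = 1 + fpsX rat * K ^+ 2 ->
    y = fpsX rat * (1 + y + y ^+ 2) *+ 2 -> B = 1 + y * (K ^+ 2 - 1) * B ->
  gen_fun c_ = succession_solution K y B 0 0.
Proof.
by move=> eqK eqy eqB; apply: fpsP => n; rewrite (fcoef_solution_c eqK eqy eqB).
Qed.

Lemma degree_gen_fun_c :
  algebraic_degree (@laurent_of_ratfun rat) (gen_fun c_)%:F 4.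
Proof.
have [K eqK] := fps_catalan rat; have [y eqy] := fps_motzkin rat.
have [B eqB'] := fps_geometric ((1 + y + y ^+ 2) *+ 2 * (K ^+ 2 - 1)).
have eqB : B = 1 + y * (K ^+ 2 - 1) * B.
  by rewrite {1}eqB' [in y * _]eqy; congr (_ + _); ring.
pose X : {poly rat} := 'X.
have [rD ra rb rc rd] := rmorph_coefs (@fps_of_poly rat) X.
(* Evaluation at [1] gives [248], [-8] and [-12] for [coef_den], [coef_c] and [coef_d], which shows
   that these polynomials are nonzero. *)
have /= := rmorph_coefs (@horner_eval rat 1) X.
rewrite /horner_eval hornerX => -[hD _ _ hc hd].
have two0 : (2 : rat) != 0 by [].
(* The constant polynomials [1/4] and [1/6] are later generalized to variables for [ring], subject
   to these relations. *)
have inv4 : (4^-1)%:P *+ 4 = 1 :> {poly rat} by rewrite -polyCMn.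
have inv6 : (6^-1)%:P *+ 6 = 1 :> {poly rat} by rewrite -polyCMn.
have neq0 (p : {poly rat}) v : p.[1] = v -> v != 0 -> p != 0.
  by move=> pv; apply: contraNneq => p0; rewrite -pv p0 horner0.
apply: (@biquad_degree_fps (1 - X *+ 4) ((1 - X *+ 6) * (1 + X *+ 2)) (coef_den X)
  (coef_a X) (coef_b X) (coef_c X) (coef_d X) (sqrt_catalan K) (sqrt_motzkin y)).
- apply: (@ratfun_nonsquare _ _ (- 4) 4^-1); last by rewrite rootE !hornerE.
  rewrite -/X; move: inv4; move: (_%:P) => c inv4; apply/subr0_eq.
  by transitivity (1 - c *+ 4); [ring | rewrite inv4 subrr].
- apply: (@ratfun_nonsquare _ _ (- 6 * (1 + X *+ 2)) 6^-1); last by rewrite rootE !hornerE.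
  rewrite -/X; move: inv6; move: (_%:P) => c inv6; apply/subr0_eq.
  by transitivity ((1 - c *+ 6) * (1 + X *+ 2)); [ring | rewrite inv6 subrr mul0r].
- apply: (@ratfun_nonsquare _ _ (- 4 * ((1 - X *+ 6) * (1 + X *+ 2))) 4^-1); last first.
    rewrite rootE /X !(hornerM, hornerD, hornerN, hornerMn, hornerX, hornerC).
    done.
  rewrite -/X; move: inv4; move: (_%:P) => c inv4; apply/subr0_eq.
  transitivity ((1 - c *+ 4) * ((1 - X *+ 6) * (1 + X *+ 2))); first by ring.
  by rewrite inv4 subrr mul0r.
- by rewrite (sqrt_catalan2 eqK) rmorphB rmorph1 rmorphMn.
- by rewrite (sqrt_motzkin2 eqy) !(rmorphM, rmorphB, rmorphD, rmorph1, rmorphMn).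
- by apply: neq0 hD _.
- by apply: neq0 hc _.
- by apply: neq0 hd _.
rewrite (gen_fun_c eqK eqy eqB) rD ra rb rc rd.
exact: solution_biquad.
Qed.

(** * Wallis integrals *)

Import numFieldNormedType.Exports.
Local Open Scope classical_set_scope.

Section Wallis.
Variable R : realType.

(* The antiderivative of [sin^n] vanishing at [0], so that [wallis n] below is
   the integral of [sin^n] over [0, pi/2]. *)
Fixpoint sin_prim n (x : R) : R :=
  match n with
  | 0 => x
  | 1 => 1 - cos x
  | (m.+1 as m').+1 => (m'%:R * sin_prim m x - sin x ^+ m' * cos x) / m.+2%:R
  end.

Lemma is_derive_sin_prim n (x : R) : is_derive x 1 (sin_prim n) (sin x ^+ n).
Proof.
suff : is_derive x 1 (sin_prim n) (sin x ^+ n) /\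
  is_derive x 1 (sin_prim n.+1) (sin x ^+ n.+1) by case.
elim: n => [|n [IHn IHn1]].
  split; first by rewrite expr0; exact: is_derive_id.
  rewrite expr1; apply: is_derive_eq.
  by rewrite add0r mul1r opprK.
split=> //.
have sinX m y : (sin ^+ m) y = sin y ^+ m :> R.
  by elim: m => [|m IHm]; rewrite ?expr0 // !exprS -IHm.
have -> : sin_prim n.+2 = (n.+2%:R^-1 *: (n.+1%:R *: sin_prim n - (sin ^+ n.+1 * cos))).
  apply/funext => y.
  rewrite -[RHS]/(n.+2%:R^-1 * (n.+1%:R * sin_prim n y - (sin ^+ n.+1) y * cos y)).
  rewrite [RHS]mulrC -[LHS]/((n.+1%:R * sin_prim n y - sin y ^+ n.+1 * cos y) / n.+2%:R).
  by congr ((_ - _ * _) * _); rewrite sinX.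
apply: is_derive_eq.
rewrite sinX /GRing.scale /=.
have cs : sin x ^+ 2 = 1 - cos x ^+ 2 by rewrite -(cos2Dsin2 x) addrAC subrr add0r.
have -> : n.+1%:R * sin x ^+ n
      - (sin x ^+ n.+1 * - sin x + cos x * (n.+1%:R * sin x ^+ n * cos x))
    = n.+1%:R * (sin x ^+ n * (1 - cos x ^+ 2)) + sin x ^+ n.+2 by rewrite !exprS; ring.
by rewrite -cs -exprD addn2 -{2}[sin x ^+ n.+2]mul1r -mulrDl natr1 mulKf ?pnatr_eq0.
Qed.

Definition wallis n := sin_prim n (pi / 2).

Lemma sin_prim0 n : sin_prim n 0 = 0.
Proof.
suff : sin_prim n 0 = 0 /\ sin_prim n.+1 0 = 0 by case.
elim: n => [|n [IHn IHn1]]; first by rewrite /= cos0 subrr.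
by split=> //=; rewrite IHn sin0 exprS !mul0r mulr0 subrr mul0r.
Qed.

Lemma wallis0 : wallis 0 = pi / 2. Proof. by []. Qed.
Lemma wallis1 : wallis 1 = 1. Proof. by rewrite /wallis /= cos_pihalf subr0. Qed.
Lemma wallisSS n : wallis n.+2 = n.+1%:R / n.+2%:R * wallis n.
Proof. by rewrite /wallis /= cos_pihalf mulr0 subr0 mulrAC. Qed.

(** The difference of the two antiderivatives has derivative [sin^n - sin^(n+1)], nonnegative
    between [0] and [pi/2]. *)
Lemma wallis_le n : wallis n.+1 <= wallis n.
Proof.
rewrite -subr_ge0 -[0](subrr (0 : R)).
rewrite -{1}[0](sin_prim0 n) -[X in _ - X <= _](sin_prim0 n.+1).
pose f := sin_prim n - sin_prim n.+1.
have df (x : R) : is_derive x 1 f (sin x ^+ n - sin x ^+ n.+1).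
  have d0 := is_derive_sin_prim n x; have d1 := is_derive_sin_prim n.+1 x.
  exact: is_deriveB.
have cf (x : R) : {for x, continuous f}.
  by apply/differentiable_continuous/derivable1_diffP; case: (df x).
rewrite -[leLHS]/(f 0) -[leRHS]/(f (pi / 2)).
have pi0 : 0 <= pi / 2 :> R by rewrite divr_ge0 ?pi_ge0.
apply: (@ger0_derive1_ndecr _ f 0 (pi / 2)) => //.
- move=> x; rewrite in_itv /= => /andP[x0 x1].
  rewrite derive1E (@derive_val _ _ _ _ _ _ _ (df x)).
  rewrite exprS -[X in X - _]mul1r -mulrBl mulr_ge0 ?subr_ge0 ?sin_le1 // exprn_ge0 //.
  rewrite sin_ge0_pi // (ltW x0) /= (le_trans (ltW x1)) // ler_pdivrMr //.
  by rewrite ler_peMr ?pi_ge0 // ler1n.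
- exact: continuous_subspaceT.
Qed.

Lemma wallis_ge0 n : 0 <= wallis n.
Proof.
suff : 0 <= wallis n /\ 0 <= wallis n.+1 by case.
elim: n => [|n [IHn IHn1]]; first by rewrite wallis1 wallis0 divr_ge0 ?pi_ge0.
by rewrite wallisSS mulr_ge0 // divr_ge0.
Qed.

Lemma wallis_prod n : wallis n * wallis n.+1 * n.+1%:R = pi / 2.
Proof.
elim: n => [|n IHn]; first by rewrite wallis0 wallis1 !mulr1.
rewrite -IHn wallisSS; set u := wallis n; set v := wallis n.+1.
have : n.+2%:R != 0 :> R by rewrite pnatr_eq0.
by move: n.+2%:R n.+1%:R => a b a0; field.
Qed.

(** By monotonicity the square lies between the products of neighbours with indices [2n, 2n + 1] and
    [2n - 1, 2n], which [wallis_prod] evaluates exactly. *)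
Lemma wallis_bounds n :
  pi / 4 * (1 - n.*2.+1%:R^-1) <= n%:R * wallis n.*2 ^+ 2 <= pi / 4.
Proof.
have w0 := wallis_ge0 n.*2; apply/andP; split.
  have -> : pi / 4 * (1 - n.*2.+1%:R^-1) = n%:R * (pi / 2 / n.*2.+1%:R) :> R.
    have a0 : n.*2.+1%:R != 0 :> R by rewrite pnatr_eq0.
    have -> : n%:R = (n.*2.+1%:R - 1) / 2 :> R by rewrite -natr1 -muln2 natrM; field.
    by move: n.*2.+1%:R a0 => a a0; field.
  apply: ler_wpM2l => //; rewrite ler_pdivrMr // -(wallis_prod n.*2) expr2.
  by rewrite ler_wpM2r // ler_wpM2l // wallis_le.
case: n w0 => [|n] w0; first by rewrite mul0r divr_ge0 ?pi_ge0.
rewrite -(ler_pM2r (_ : 0 < 2)) // [leRHS](_ : _ = pi / 2); last by field.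
rewrite -(wallis_prod n.*2.+1) doubleS expr2.
rewrite [leLHS](_ : _ = wallis n.*2.+2 * wallis n.*2.+2 * n.*2.+2%:R); last first.
  have -> : n.*2.+2%:R = n.+1%:R * 2 :> R by rewrite -natrM muln2 doubleS.
  by ring.
rewrite doubleS in w0; by rewrite ler_wpM2r // ler_wpM2r // wallis_le.
Qed.

Lemma wallis_cvg : (fun n => Num.sqrt n%:R * wallis n.*2) @ \oo --> Num.sqrt pi / 2.
Proof.
have -> : (fun n => Num.sqrt n%:R * wallis n.*2)
    = Num.sqrt \o (fun n => n%:R * wallis n.*2 ^+ 2).
  by apply/funext => n /=; rewrite sqrtrM // sqrtr_sqr ger0_norm // wallis_ge0.
have -> : Num.sqrt pi / 2 = Num.sqrt (pi / 4) :> R.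
  rewrite sqrtrM ?pi_ge0 // sqrtrV // (_ : 4 = 2 ^+ 2); last by ring.
  by rewrite sqrtr_sqr ger0_norm.
apply: continuous_cvg; first exact: sqrt_continuous.
apply: squeeze_cvgr; first by near=> n; exact: wallis_bounds.
  have h : (fun n => n.*2.+1%:R^-1 : R) @ \oo --> (0 : R).
    apply: squeeze_cvgr (cvg_cst 0) (@cvg_harmonic R); near=> n.
    by rewrite invr_ge0 ler0n /= lef_pV2 ?posrE // ler_nat ltnS -addnn leq_addr.
  by have := cvgM (cvg_cst (pi / 4)) (cvgB (cvg_cst (1 : R)) h); rewrite subr0 mulr1; apply.
exact: cvg_cst.
Unshelve. all: by end_near. Qed.
End Wallis.

(** * Tannery's theorem *)

Section Tannery.
Variable R : realType.
Implicit Types (a b : nat -> R).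

Lemma eq_cvgn a b (l : R) : a =1 b -> a @ \oo --> l -> b @ \oo --> l.
Proof. by move=> /funext ->. Qed.

Lemma cvgnD a b (l m : R) : a @ \oo --> l -> b @ \oo --> m ->
  (fun n => a n + b n) @ \oo --> l + m.
Proof. by move=> al bm; apply: cvgD. Qed.

Lemma cvgnB a b (l m : R) : a @ \oo --> l -> b @ \oo --> m ->
  (fun n => a n - b n) @ \oo --> l - m.
Proof. by move=> al bm; apply: cvgB. Qed.

Lemma cvgnN a (l : R) : a @ \oo --> l -> (fun n => - a n) @ \oo --> - l.
Proof. by move=> al; apply: cvgN. Qed.

Lemma cvgnM a b (l m : R) : a @ \oo --> l -> b @ \oo --> m ->
  (fun n => a n * b n) @ \oo --> l * m.
Proof. by move=> al bm; apply: cvgM. Qed.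

Lemma cvgnMl a (c l : R) : a @ \oo --> l -> (fun n => c * a n) @ \oo --> c * l.
Proof. by move=> al; apply: cvgnM al; exact: cvg_cst. Qed.

Lemma cvgnS a (l : R) : a @ \oo --> l -> (fun n => a n.+1) @ \oo --> l.
Proof. by move=> al; rewrite -cvg_shiftS in al. Qed.

Lemma cvgn_pred a (l : R) : (fun n => a n.+1) @ \oo --> l -> a @ \oo --> l.
Proof. by move=> al; rewrite -cvg_shiftS. Qed.

Definition abs_summable a := exists C, forall n, \sum_(0 <= i < n) `|a i| <= C.

Lemma abs_summable_normed a : abs_summable a -> cvgn (series (fun i => `|a i|)).
Proof.
move=> [C aC]; apply: nondecreasing_is_cvgn.
  by apply: nondecreasing_series => n _ _.
by exists C => _ [n _ <-]; exact: aC.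
Qed.

Lemma abs_summable_tail a : abs_summable a ->
  forall e, 0 < e -> exists N, forall n, \sum_(N <= i < n) `|a i| <= e.
Proof.
move=> sa e e0; have /cauchy_cvgP/cauchy_seriesP/(_ e e0) := abs_summable_normed sa.
case=> -[A1 A2] /= [[N1 _ hN1] [N2 _ hN2]] AB.
exists (maxn N1 N2) => n; have [nN|nN] := leqP n (maxn N1 N2).
  by rewrite big_geq // ltW.
have := AB (maxn N1 N2, n) _; rewrite /= ger0_norm ?sumr_ge0 // => h.
apply/ltW/h; split; first by apply: hN1; rewrite /= leq_maxl.
by apply: hN2; rewrite /= (leq_trans (leq_maxr N1 N2)) // ltnW.
Qed.

(** The majorant makes the tail beyond a fixed [N] small uniformly in [n]; the finitely many terms
    before [N] tend to zero. The bound [n <= b n] puts every fixed [N] inside the range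
    eventually. *)
Lemma tannery0 (v : nat -> nat -> R) a (b : nat -> nat) : abs_summable a ->
    (forall n, (n <= b n)%N) -> (forall n i, `|v n i| <= `|a i|) ->
    (forall i, v n i @[n --> \oo] --> (0 : R)) ->
  (\sum_(0 <= i < b n) v n i) @[n --> \oo] --> (0 : R).
Proof.
move=> sa nb va v0; apply/cvgr0Pnorm_le => e e0.
have e20 : 0 < e / 2 by rewrite divr_gt0.
have [N aN] := abs_summable_tail sa e20.
have fin : (\sum_(0 <= i < N) v n i) @[n --> \oo] --> (0 : R).
  elim: N {aN} => [|N IHN].
    by apply: eq_cvgn (cvg_cst 0) => n; rewrite big_geq.
  have := cvgnD IHN (v0 N); rewrite addr0; apply: eq_cvgn => n.
  by rewrite big_nat_recr.
near=> n.
have Nb : (N <= b n)%N by apply: leq_trans (nb n); near: n; exists N.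
rewrite (big_cat_nat (leq0n N) Nb) /= (le_trans (ler_normD _ _)) // [e]splitr lerD //.
  by near: n; exact: (cvgr0_norm_le _ fin _ e20).
rewrite (le_trans (ler_norm_sum _ _ _)) // (le_trans _ (aN (b n))) //.
by apply: ler_sum => i _.
Unshelve. all: by end_near. Qed.

Lemma tannery (v : nat -> nat -> R) a (b : nat -> nat) (u : nat -> R) (L : R) :
    abs_summable a -> (forall n, (n <= b n)%N) -> (forall n i, `|v n i| <= `|a i|) ->
    (forall i, v n i @[n --> \oo] --> u i) ->
    (\sum_(0 <= i < b n) u i) @[n --> \oo] --> L ->
  (\sum_(0 <= i < b n) v n i) @[n --> \oo] --> L.
Proof.
move=> [C aC] nb va vu uL.
have ua i : `|u i| <= `|a i|.
  have h : (fun n => `|v n i|) @ \oo --> (`|u i| : R) by apply: cvg_norm; exact: vu.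
  have hc : (fun _ : nat => `|a i|) @ \oo --> (`|a i| : R) by exact: cvg_cst.
  by apply: (ler_cvg_to h hc); exact: nearW.
have : (\sum_(0 <= i < b n) (v n i - u i)) @[n --> \oo] --> (0 : R).
  apply: (@tannery0 _ (fun i => `|a i| *+ 2)) => //.
  - exists (C *+ 2) => n; under eq_bigr do rewrite normrMn normr_id.
    by rewrite sumrMnl lerMn2r /= aC.
  - move=> n i; rewrite normrMn normr_id mulr2n (le_trans (ler_normB _ _)) // lerD //.
  - by move=> i; rewrite -(subrr (u i)); apply: cvgB; [exact: vu | exact: cvg_cst].
move=> h; have := cvgnD h uL; rewrite add0r; apply: eq_cvgn => n.
by rewrite /= -big_split /=; apply: eq_bigr => i _; rewrite subrK.
Qed.

Lemma abs_summable_cvg a : abs_summable a ->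
  exists L : R, (\sum_(0 <= i < n) a i) @[n --> \oo] --> L.
Proof.
by move=> sa; exists (limn (series a)); apply: normed_cvg (abs_summable_normed sa).
Qed.
End Tannery.

(** * Sequences of order n^(-3/2) *)

Section Asymptotics.
Variable R : realType.
Implicit Types (f g : fps R) (a : nat -> R).

Lemma cvgn_bounded a (l : R) : a @ \oo --> l -> exists C, forall n, `|a n| <= C.
Proof.
move=> al; have /cvg_seq_bounded[M [_ hM]] : cvgn a by apply/cvg_ex; exists l.
by exists (M + 1) => n; apply: hM => //; rewrite ltrDl.
Qed.

Definition psi (n : nat) : R := n%:R * Num.sqrt n%:R.

Lemma psi_ge0 n : 0 <= psi n.
Proof. by rewrite mulr_ge0 ?sqrtr_ge0. Qed.

Lemma le_psi n m : (n <= m)%N -> psi n <= psi m.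
Proof. by move=> nm; rewrite ler_pM ?sqrtr_ge0 ?ler_nat // ler_wsqrtr // ler_nat. Qed.

(** The sharp factor is [r^(3/2)]; the cruder [r^2] suffices and avoids fractional powers. *)
Lemma psi_scale (r : R) n m : 1 <= r -> n%:R <= r * m%:R -> psi n <= r ^+ 2 * psi m.
Proof.
move=> r1 nm; have r0 : 0 <= r by apply: le_trans r1.
rewrite [leRHS](_ : _ = r * m%:R * (r * Num.sqrt m%:R)); last by rewrite /psi; ring.
rewrite ler_pM ?sqrtr_ge0 // (le_trans (ler_wsqrtr nm)) //.
rewrite sqrtrM // ler_wpM2r ?sqrtr_ge0 // -[leRHS]ger0_norm // -sqrtr_sqr ler_wsqrtr //.
by rewrite expr2 ler_peMl.
Qed.

Lemma psi_double n m : (n <= m.*2)%N -> psi n <= 4 * psi m.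
Proof.
move=> nm; rewrite (_ : 4 = 2 ^+ 2); last by ring.
by apply: psi_scale; rewrite ?ler1n // -natrM mul2n ler_nat.
Qed.

Lemma psiS_le n : (0 < n)%N -> n%:R * psi n.+1 <= (n%:R + 3) * psi n.
Proof.
move=> n0; have n1 : 1 <= n%:R :> R by rewrite ler1n.
have h : n%:R * Num.sqrt n.+1%:R <= n.+1%:R * Num.sqrt n%:R :> R.
  rewrite -[leLHS]ger0_norm ?mulr_ge0 ?sqrtr_ge0 //.
  rewrite -[leRHS]ger0_norm ?mulr_ge0 ?sqrtr_ge0 //.
  rewrite -ler_sqr ?nnegrE // !real_normK ?num_real // !exprMn !sqr_sqrtr //.
  by rewrite -natr1; move: n1; move: n%:R => x x1; nra.
rewrite /psi mulrCA (le_trans (ler_wpM2l _ h)) // !mulrA ler_wpM2r ?sqrtr_ge0 //.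
by rewrite -natr1; move: n1; move: n%:R => x x1; nra.
Qed.

(** By [psiS_le] the relative increment of [psi] is at most [3/n]; with [n + 1 <= 2n] this gives the
    bound [6 C / (n + 1)]. *)
Lemma psi_shift_cvg0 a C : (forall n, psi n * `|a n| <= C) ->
  (fun n => psi n.+1 * a n - psi n * a n) @ \oo --> (0 : R).
Proof.
move=> aC; apply/cvgr0Pnorm_le => e e0.
have h : (fun n => 6 * C * harmonic n) @ \oo --> (0 : R).
  by have := @cvgnMl _ _ (6 * C) _ (@cvg_harmonic R); rewrite mulr0.
have C0 : 0 <= C by apply: le_trans (aC 0%N); rewrite mulr_ge0 ?psi_ge0.
near=> n.
have n0 : (0 < n)%N by near: n; exists 1%N.
apply: (@le_trans _ _ (6 * C * harmonic n)); last first.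
  rewrite -[leLHS]ger0_norm ?mulr_ge0 ?invr_ge0 //.
  by near: n; exact: (cvgr0_norm_le _ h _ e0).
rewrite -mulrBl normrM ger0_norm ?subr_ge0 ?le_psi //= ler_pdivlMr //.
have n1 : 1 <= n%:R :> R by rewrite ler1n.
rewrite mulrC; have := psiS_le n0; have := aC n; have := psi_ge0 n.
have := le_psi (leqnSn n); rewrite -[n.+1%:R]natr1.
move: (psi n.+1) (psi n) (`|a n|) (normr_ge0 (a n)) n1 => p' p b b0.
move: n%:R => x x1 pp' p0 pb hp.
have : x * ((p' - p) * b) <= 3 * C.
  have : x * (p' - p) <= 3 * p by lra.
  move/(ler_wpM2r b0); rewrite -mulrA => /le_trans; apply.
  by rewrite -mulrA ler_wpM2l.
have : (x + 1) * ((p' - p) * b) <= 2 * (x * ((p' - p) * b)).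
  have q0 : 0 <= (p' - p) * b by rewrite mulr_ge0 ?subr_ge0.
  by move: ((p' - p) * b) q0 => q q0; nra.
lra.
Unshelve. all: by end_near. Qed.

Lemma psi_cvgS a (l : R) : (fun n => psi n * a n) @ \oo --> l ->
  (fun n => psi n.+1 * a n) @ \oo --> l.
Proof.
move=> al; have [C aC] := cvgn_bounded al.
have /psi_shift_cvg0 h : forall n, psi n * `|a n| <= C.
  by move=> n; rewrite -{1}[psi n]ger0_norm ?psi_ge0 // -normrM.
by have := cvgnD h al; rewrite add0r; apply: eq_cvgn => n; rewrite subrK.
Qed.

Lemma psi_cvg_pred a (l : R) : (fun n => psi n.+1 * a n) @ \oo --> l ->
  (fun n => psi n * a n) @ \oo --> l.
Proof.
move=> al; have [C aC] := cvgn_bounded al.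
have /psi_shift_cvg0 h : forall n, psi n * `|a n| <= C.
  move=> n; apply: le_trans (aC n); rewrite normrM [`|psi _|]ger0_norm ?psi_ge0 //.
  by rewrite ler_wpM2r // le_psi.
by have := cvgnB al h; rewrite subr0; apply: eq_cvgn => n; rewrite opprB addrC subrK.
Qed.

Lemma psi_cvg_sub a (l : R) i : (fun n => psi n * a n) @ \oo --> l ->
  (fun n => psi n * a (n - i)%N) @ \oo --> l.
Proof.
elim: i => [|i IHi] al; first by apply: eq_cvgn al => n; rewrite subn0.
apply: cvgn_pred; apply: eq_cvgn (psi_cvgS (IHi al)) => n.
by rewrite subSS.
Qed.

Lemma partial_sumM f g N : \sum_(0 <= n < N) fcoef (f * g) n =
  \sum_(0 <= i < N) fcoef f i * \sum_(0 <= j < N - i) fcoef g j.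
Proof.
elim: N => [|N IHN]; first by rewrite !big_geq.
rewrite big_nat_recr // IHN fcoefM [in RHS]big_nat_recr //= subSnn big_nat1.
rewrite big_ord_recr /= subnn addrA; congr (_ + _).
rewrite -(big_mkord xpredT (fun i => fcoef f i * fcoef g (N - i))) -big_split /=.
apply: eq_big_nat => i /andP[_ iN]; rewrite (subSn (ltnW iN)).
by rewrite [in RHS]big_nat_recr //= mulrDr.
Qed.

(** In either part the other index is at least [n/2], where [psi] is comparable to [psi n]. The
    strict inequality in the second part keeps the middle term from being counted twice. *)
Lemma sum_halves (h : nat -> nat -> R) n :
  \sum_(i < n.+1) h i (n - i)%N =
    \sum_(0 <= i < n.+1) (if (i.*2 <= n)%N then h i (n - i)%N else 0)
    + \sum_(0 <= j < n.+1) (if (j.*2 < n)%N then h (n - j)%N j else 0).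
Proof.
rewrite [X in _ + X]big_nat_rev /= -(big_mkord xpredT (fun i => h i (n - i)%N)).
rewrite -big_split /=.
apply: eq_big_nat => i /andP[_ iN]; rewrite add0n subSS subKn //.
have -> : ((n - i).*2 < n)%N = ~~ (i.*2 <= n)%N by lia.
by case: ifP => _; rewrite ?addr0 ?add0r.
Qed.

Lemma half_tannery (a t : nat -> R) (P : nat -> nat -> bool) (S k : R) :
    abs_summable a -> (fun n => \sum_(0 <= i < n) a i) @ \oo --> S ->
    (fun n => psi n * t n) @ \oo --> k ->
    (forall n i, P n i -> (i.*2 <= n)%N) -> (forall i, \forall n \near \oo, P n i) ->
  (fun n => \sum_(0 <= i < n.+1) (if P n i then a i * (psi n * t (n - i)%N) else 0))
    @ \oo --> S * k.
Proof.
move=> [C aC] aS tk Pn Pi; have [A tA] := cvgn_bounded tk.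
have A0 : 0 <= A by apply: le_trans (tA 0%N).
apply: (@tannery _ _ (fun i => 4 * A * a i) _ (fun i => a i * k)).
- exists (4 * A * C) => n; under eq_bigr do rewrite normrM ger0_norm ?mulr_ge0 //.
  by rewrite -mulr_sumr ler_wpM2l ?mulr_ge0.
- by move=> n.
- move=> n i; case: ifP => [/Pn ni|_]; last by rewrite normr0.
  rewrite normrM [`|psi n * _|]normrM [`|_ * a i|]normrM mulrC.
  rewrite [`|4 * A|]ger0_norm ?mulr_ge0 // ler_wpM2r // [`|psi n|]ger0_norm ?psi_ge0 //.
  have h : psi n <= 4 * psi (n - i) by apply: psi_double; lia.
  rewrite (le_trans (ler_wpM2r _ h)) // -mulrA ler_wpM2l //.
  by have := tA (n - i)%N; rewrite normrM ger0_norm ?psi_ge0.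
- move=> i; have h := @cvgnMl _ _ (a i) _ (psi_cvg_sub i tk).
  apply: cvg_trans h; apply: near_eq_cvg; near=> n.
  by have -> : P n i by near: n; exact: Pi.
have h : (fun n => (\sum_(0 <= i < n) a i) * k) @ \oo --> S * k.
  by apply: cvgnM aS _; exact: cvg_cst.
by apply: eq_cvgn (cvgnS h) => n; rewrite mulr_suml.
Unshelve. all: by end_near. Qed.

(* The pair [(S, k)] behaves like the dual number [S + k eps], see [asymM]. *)
Definition asym f (S k : R) := [/\ abs_summable (fcoef f),
  (fun n => \sum_(0 <= i < n) fcoef f i) @ \oo --> S &
  (fun n => psi n * fcoef f n) @ \oo --> k].

Lemma asymD f g S k T l : asym f S k -> asym g T l -> asym (f + g) (S + T) (k + l).
Proof.
move=> [[C fC] fS fk] [[D gD] gT gl]; split.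
- exists (C + D) => n; rewrite (le_trans _ (lerD (fC n) (gD n))) // -big_split.
  by apply: ler_sum => i _; exact: ler_normD.
- by apply: eq_cvgn (cvgnD fS gT) => n; rewrite -big_split.
- by apply: eq_cvgn (cvgnD fk gl) => n; rewrite -mulrDr.
Qed.

Lemma asymN f S k : asym f S k -> asym (- f) (- S) (- k).
Proof.
move=> [[C fC] fS fk]; split.
- by exists C => n; rewrite (le_trans _ (fC n)) //; apply: ler_sum => i _; rewrite normrN.
- by apply: eq_cvgn (cvgnN fS) => n; rewrite -sumrN.
- by apply: eq_cvgn (cvgnN fk) => n; rewrite -mulrN.
Qed.

Lemma asymB f g S k T l : asym f S k -> asym g T l -> asym (f - g) (S - T) (k - l).
Proof. by move=> fS gT; apply/asymD/asymN. Qed.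

Definition fabs f : fps R := FPS (fun n => `|fcoef f n|).

Lemma norm_fcoefM f g n : `|fcoef (f * g) n| <= fcoef (fabs f * fabs g) n.
Proof.
rewrite !fcoefM (le_trans (ler_norm_sum _ _ _)) //.
by apply: ler_sum => i _; rewrite normrM.
Qed.

Lemma abs_summableM f g : abs_summable (fcoef f) -> abs_summable (fcoef g) ->
  abs_summable (fcoef (f * g)).
Proof.
move=> [C fC] [D gD]; exists (C * D) => n.
have D0 : 0 <= D by apply: le_trans (gD 0%N); rewrite big_geq.
rewrite (@le_trans _ _ (\sum_(0 <= i < n) fcoef (fabs f * fabs g) i)) //.
  by apply: ler_sum => i _; exact: norm_fcoefM.
rewrite partial_sumM (le_trans _ (ler_wpM2r D0 (fC n))) // mulr_suml.
by apply: ler_sum => i _; rewrite ler_wpM2l ?normr_ge0 //; exact: gD.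
Qed.

Lemma sum_cvgM f g (S T : R) : abs_summable (fcoef f) -> abs_summable (fcoef g) ->
    (fun n => \sum_(0 <= i < n) fcoef f i) @ \oo --> S ->
    (fun n => \sum_(0 <= i < n) fcoef g i) @ \oo --> T ->
  (fun n => \sum_(0 <= i < n) fcoef (f * g) i) @ \oo --> S * T.
Proof.
move=> [C fC] [D gD] fS gT.
have D0 : 0 <= D by apply: le_trans (gD 0%N); rewrite big_geq.
suff h : (fun n => \sum_(0 <= i < n) (fcoef f i * \sum_(0 <= j < n - i) fcoef g j))
    @ \oo --> S * T.
  by apply: eq_cvgn h => n; rewrite partial_sumM.
apply: (@tannery _ _ (fun i => D * fcoef f i) id (fun i => fcoef f i * T)) => //.
- exists (D * C) => n; under eq_bigr do rewrite normrM ger0_norm //.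
  by rewrite -mulr_sumr ler_wpM2l.
- move=> n i; rewrite !normrM mulrC [`|D|]ger0_norm // ler_wpM2r //.
  by rewrite (le_trans (ler_norm_sum _ _ _)).
- move=> i; apply: cvgnMl; rewrite -(cvg_shiftn i).
  by apply: eq_cvgn gT => n; rewrite /= addnK.
have h : (fun n => (\sum_(0 <= i < n) fcoef f i) * T) @ \oo --> S * T.
  by apply: cvgnM fS _; exact: cvg_cst.
by apply: eq_cvgn h => n; rewrite mulr_suml.
Qed.

(** In a long convolution one index stays bounded while the other grows: bounded indices in [f]
    contribute [S l], bounded indices in [g] contribute [T k]. *)
Lemma asymM f g S k T l : asym f S k -> asym g T l ->
  asym (f * g) (S * T) (S * l + T * k).
Proof.
move=> [sf fS fk] [sg gT gl]; split.
- exact: abs_summableM.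
- exact: sum_cvgM.
have h1 := @half_tannery _ _ (fun n i => (i.*2 <= n)%N) _ _ sf fS gl (fun n i ni => ni) _.
have h2 := @half_tannery _ _ (fun n i => (i.*2 < n)%N) _ _ sg gT fk _ _.
apply: eq_cvgn (cvgnD (h1 _) (h2 _ _)) => [n|i|n i|i].
- rewrite fcoefM mulr_sumr (sum_halves (fun i j => psi n * (fcoef f i * fcoef g j))).
  by congr (_ + _); apply: eq_bigr => i _; case: ifP => _ //; ring.
- by exists i.*2 => // n /=.
- exact: ltnW.
- by exists i.*2.+1 => // n /=.
Qed.

Lemma asym_uniq f S k T l : asym f S k -> asym f T l -> S = T /\ k = l.
Proof.
move=> [_ fS fk] [_ fT fl].
by split; [exact: (cvg_unique _ fS fT) | exact: (cvg_unique _ fk fl)].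
Qed.

End Asymptotics.

(** * Exponentially small coefficients, shifts and scalings *)

Section SeriesOperations.
Variable R : realType.
Implicit Types (f g : fps R).

Lemma sum_expr_le (q : R) n : 0 <= q < 1 -> \sum_(0 <= i < n) q ^+ i <= (1 - q)^-1.
Proof.
move=> /andP[q0 q1]; rewrite -[leRHS]mul1r ler_pdivlMr ?subr_gt0 // big_mkord.
have -> : (\sum_(i < n) q ^+ i) * (1 - q) = 1 - q ^+ n.
  by rewrite -opprB mulrN mulrC -subrX1 opprB.
by rewrite lerBlDr lerDl exprn_ge0.
Qed.

Lemma muln_expr_le (q : R) n : 0 <= q < 1 -> n%:R * q ^+ n <= (1 - q)^-1.
Proof.
move=> q01; apply: le_trans (sum_expr_le n q01); have /andP[q0 q1] := q01.
rewrite mulr_natl -[n in _ *+ n]subn0 -sumr_const_nat.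
apply: ler_sum_nat => i /andP[_ /ltnW iN]; apply: ler_wiXn2l => //; exact: ltW.
Qed.

Lemma psi_expr_cvg0 (q : R) : 0 <= q < 1 -> (fun n => psi R n * q ^+ n) @ \oo --> (0 : R).
Proof.
move=> /andP[q0 q1].
(* With [q = p^4], two of the four factors [p^n] absorb [n^2 >= psi n], and the other two still tend
   to zero. *)
pose p := Num.sqrt (Num.sqrt q).
have p0 : 0 <= p by exact: sqrtr_ge0.
have qp : q = p ^+ 4.
  by rewrite -[4%N]/(2 * 2)%N exprM !sqr_sqrtr ?sqrtr_ge0.
have p1 : p < 1 by move: q1; rewrite qp expr_lt1.
have p01 : 0 <= p < 1 by rewrite p0.
have pp1 : `|p ^+ 2| < 1 by rewrite ger0_norm ?exprn_ge0 // expr_lt1.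
have h : (fun n => (1 - p)^-2 * (p ^+ 2) ^+ n) @ \oo --> (0 : R).
  have := @cvgnMl _ _ ((1 - p)^-2) _ (@cvg_expr R _ pp1); rewrite mulr0; exact.
apply: (squeeze_cvgr _ (cvg_cst 0) h); apply: nearW => n.
rewrite mulr_ge0 ?psi_ge0 ?exprn_ge0 //=.
have -> : q ^+ n = p ^+ n ^+ 2 * (p ^+ 2) ^+ n.
  by rewrite qp -!exprM -exprD; congr (_ ^+ _); lia.
rewrite mulrA ler_wpM2r ?exprn_ge0 //.
apply: (@le_trans _ _ ((n%:R * p ^+ n) ^+ 2)).
  rewrite exprMn ler_wpM2r ?exprn_ge0 // /psi expr2.
  case: n => [|n]; first by rewrite !mul0r.
  rewrite ler_wpM2l // -[leRHS]ger0_norm // -sqrtr_sqr ler_wsqrtr //.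
  by rewrite expr2 ler_peMr // ler1n.
rewrite -exprVn ler_sqr ?nnegrE ?mulr_ge0 ?exprn_ge0 ?invr_ge0 ?subr_ge0 ?(ltW p1) //.
by rewrite muln_expr_le.
Qed.

Lemma asym_expdecay f (M q : R) : 0 <= q < 1 ->
  (forall n, `|fcoef f n| <= M * q ^+ n) -> exists S, asym f S 0.
Proof.
move=> q01 fM.
have M0 : 0 <= M by have := fM 0%N; rewrite expr0 mulr1; exact: le_trans.
have sf : abs_summable (fcoef f).
  exists (M * (1 - q)^-1) => n; rewrite (le_trans (ler_sum _ (fun i _ => fM i))) //.
  by rewrite -mulr_sumr ler_wpM2l // sum_expr_le.
have [S fS] := abs_summable_cvg sf; exists S; split=> //.
apply/cvgr0Pnorm_le => e e0.
have h : (fun n => M * (psi R n * q ^+ n)) @ \oo --> (0 : R).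
  by have := @cvgnMl _ _ M _ (psi_expr_cvg0 q01); rewrite mulr0; exact.
near=> n.
apply: (@le_trans _ _ `|M * (psi R n * q ^+ n)|); last first.
  by near: n; exact: (cvgr0_norm_le _ h _ e0).
have qn0 : 0 <= q ^+ n by case/andP: q01 => q0 _; exact: exprn_ge0.
have r0 : 0 <= M * (psi R n * q ^+ n).
  by apply: mulr_ge0 => //; apply: mulr_ge0 => //; exact: psi_ge0.
rewrite (ger0_norm r0) normrM (ger0_norm (psi_ge0 R n)) mulrCA.
by apply: ler_wpM2l; [exact: psi_ge0 | exact: fM].
Unshelve. all: by end_near. Qed.

Definition fpsC (c : R) : fps R := fps_of_poly c%:P.

Lemma fcoefCM c f n : fcoef (fpsC c * f) n = c * fcoef f n.
Proof.
rewrite fcoefM big_ord_recl big1 ?addr0 /= ?coefC ?subn0 //= => i _.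
by rewrite coefC mul0r.
Qed.

Lemma asymC c : asym (fpsC c) c 0.
Proof.
have [S fS] : exists S, asym (fpsC c) S 0.
  apply: (@asym_expdecay _ `|c| 0) => [|n]; first by rewrite lexx ltr01.
  by rewrite /= coefC expr0n; case: n => [|n] /=; rewrite ?mulr1 // normr0 mulr0.
suff eS : c = S by rewrite {2}eS.
have [_ cS _] := fS; apply: (cvg_unique _ _ cS) => //; apply: cvgn_pred.
have h : (fun _ : nat => c) @ \oo --> c by exact: cvg_cst.
apply: eq_cvgn h => n; rewrite big_nat_recl // big1 /= ?coefC ?addr0 // => i _.
by rewrite coefC.
Qed.

Lemma asym1 : asym (1 : fps R) 1 0.
Proof. by have := asymC 1; rewrite /fpsC rmorph1. Qed.

Lemma sum_fcoefXM f n (h : R -> R) : h 0 = 0 ->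
  \sum_(0 <= i < n.+1) h (fcoef (fpsX R * f) i) = \sum_(0 <= i < n) h (fcoef f i).
Proof.
move=> h0; rewrite big_nat_recl // fcoefXM0 h0 add0r.
by apply: eq_bigr => i _; rewrite fcoefXMS.
Qed.

(** The converse direction divides by [z]: the square root series give access only to [z K] and
    [z y]. *)
Lemma asym_XM f S k : asym f S k <-> asym (fpsX R * f) S k.
Proof.
split=> -[[C fC] fS fk]; split.
- exists C => -[|n]; first by have := fC 0%N; rewrite !big_geq.
  by rewrite (@sum_fcoefXM _ _ (fun x => `|x|)) // normr0.
- by apply: cvgn_pred; apply: eq_cvgn fS => n; rewrite (@sum_fcoefXM _ _ id).
- by apply: cvgn_pred; apply: eq_cvgn (psi_cvgS fk) => n; rewrite fcoefXMS.
- by exists C => n; rewrite -(@sum_fcoefXM _ _ (fun x => `|x|)) ?normr0.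
- by apply: eq_cvgn (cvgnS fS) => n; rewrite (@sum_fcoefXM _ _ id).
by apply: psi_cvg_pred; apply: eq_cvgn (cvgnS fk) => n; rewrite fcoefXMS.
Qed.

Lemma asymX : asym (fpsX R) 1 0.
Proof. by rewrite -[fpsX R]mulr1; exact: (asym_XM _ _ _).1 asym1. Qed.

Definition fscale (c : R) f : fps R := FPS (fun n => fcoef f n * c ^+ n).

Lemma fscaleM c f g : fscale c (f * g) = fscale c f * fscale c g.
Proof.
apply: fpsP => n; rewrite fcoefM [LHS]mulr_suml; apply: eq_bigr => i _ /=.
have -> : c ^+ n = c ^+ i * c ^+ (n - i) by rewrite -exprD subnKC // -ltnS.
by ring.
Qed.

Lemma fscaleD c f g : fscale c (f + g) = fscale c f + fscale c g.
Proof. by apply: fpsP => n; rewrite /= mulrDl. Qed.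

Lemma fscaleB c f g : fscale c (f - g) = fscale c f - fscale c g.
Proof. by apply: fpsP => n; rewrite /= mulrBl. Qed.

Lemma fscaleC c d : fscale c (fpsC d) = fpsC d.
Proof. by apply: fpsP => -[|n]; rewrite /= coefC /= ?mulr1 // mul0r. Qed.

Lemma fscale1 c : fscale c 1 = 1.
Proof. by have := fscaleC c 1; rewrite /fpsC rmorph1. Qed.

Lemma fscaleX c : fscale c (fpsX R) = fpsC c * fpsX R.
Proof.
apply: fpsP => n; rewrite fcoefCM /= coefX.
by case: n => [|[|n]]; rewrite ?mulr0 ?mul0r //= mul1r mulr1.
Qed.

Lemma fscale_fscale c d f : fscale c (fscale d f) = fscale (c * d) f.
Proof. by apply: fpsP => n /=; rewrite exprMn; ring. Qed.

(** The Euler operator [z d/dz]. *)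
Definition theta f : fps R := FPS (fun n => n%:R * fcoef f n).

Lemma thetaM f g : theta (f * g) = theta f * g + f * theta g.
Proof.
apply: fpsP => n; rewrite fcoefD !fcoefM [LHS]mulr_sumr -big_split.
apply: eq_bigr => i _ /=.
have -> : n%:R = i%:R + (n - i)%:R :> R by rewrite -natrD subnKC // -ltnS.
by ring.
Qed.

End SeriesOperations.

(** * Renewal sequences *)

Section Renewal.
Variable R : realType.
Implicit Types (f g : fps R).

Lemma partial_sum_le (a : nat -> R) (S : R) : (forall n, 0 <= a n) ->
  (fun n => \sum_(0 <= i < n) a i) @ \oo --> S -> forall n, \sum_(0 <= i < n) a i <= S.
Proof.
move=> a0 aS n.
have h : (fun _ : nat => \sum_(0 <= i < n) a i) @ \oo --> (\sum_(0 <= i < n) a i : R).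
  exact: cvg_cst.
apply: (ler_cvg_to h aS); exists n => // m /= nm.
by rewrite (big_cat_nat (leq0n n) nm) /= lerDl sumr_ge0.
Qed.

(** Only boundedness is asked for, because the lemma is applied to [B * B] before the limit for [B]
    is known. *)
Lemma psi_boundM f g : abs_summable (fcoef f) -> abs_summable (fcoef g) ->
    (exists C, forall n, psi R n * `|fcoef f n| <= C) ->
    (exists C, forall n, psi R n * `|fcoef g n| <= C) ->
  exists C, forall n, psi R n * `|fcoef (f * g) n| <= C.
Proof.
move=> [C fC] [D gD] [A fA] [B gB]; exists (4 * B * C + 4 * A * D) => n.
have A0 : 0 <= A by apply: le_trans (fA 0%N); apply: mulr_ge0; rewrite ?psi_ge0.
have B0 : 0 <= B by apply: le_trans (gB 0%N); apply: mulr_ge0; rewrite ?psi_ge0.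
have le4 m b E : (n <= m.*2)%N -> psi R m * b <= E -> 0 <= b -> psi R n * b <= 4 * E.
  move=> nm mb b0; apply: le_trans (ler_wpM2r b0 (psi_double R nm)) _.
  by rewrite -mulrA ler_wpM2l.
apply: le_trans (ler_wpM2l (psi_ge0 R n) (norm_fcoefM f g n)) _.
rewrite fcoefM mulr_sumr.
apply: (@le_trans _ _
  (\sum_(i < n.+1) (4 * B * `|fcoef f i| + 4 * A * `|fcoef g (n - i)|))).
  apply: ler_sum => i _ /=; have iN : (i <= n)%N by rewrite -ltnS.
  have [ni|ni] := leqP i.*2 n.
    rewrite mulrCA mulrC -[leLHS]addr0 lerD ?mulr_ge0 // ler_wpM2r //.
    by apply: (le4 (n - i)%N); rewrite ?gB //; lia.
  rewrite mulrA -[leLHS]add0r lerD ?mulr_ge0 // ler_wpM2r //.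
  by apply: (le4 i); rewrite ?fA //; lia.
rewrite big_split /= -!mulr_sumr lerD // ler_wpM2l ?mulr_ge0 //.
  by have := fC n.+1; rewrite big_mkord.
have := gD n.+1; rewrite big_mkord (reindex_inj rev_ord_inj) /=.
by under eq_bigr do rewrite subSS.
Qed.

Variables (J B : fps R) (s k : R).
Hypotheses (asymJ : asym J s k) (J_ge0 : forall n, 0 <= fcoef J n)
  (J0 : fcoef J 0 = 0) (s1 : s < 1) (eqB : B = 1 + J * B).

Lemma renewal_ge0 n : 0 <= fcoef B n.
Proof.
elim/ltn_ind: n => n IHn; rewrite eqB fcoefD fcoef1 fcoefM addr_ge0 // sumr_ge0 // => i _.
have [->|i0] := posnP i; first by rewrite J0 mul0r.
by rewrite mulr_ge0 // IHn //; have := ltn_ord i; lia.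
Qed.

Let sumJ : forall n, \sum_(0 <= i < n) fcoef J i <= s.
Proof. by have [_ Js _] := asymJ; exact: partial_sum_le. Qed.

Let s0 : 0 <= s. Proof. by have := sumJ 0; rewrite big_geq. Qed.

(** Since all terms are nonnegative, replacing the shorter partial sums of [B] by the full one, [b],
    in the product gives [b <= 1 + s b]. *)
Lemma renewal_sum_le N : \sum_(0 <= i < N) fcoef B i <= (1 - s)^-1.
Proof.
rewrite -[leRHS]mul1r ler_pdivlMr ?subr_gt0 // mulrBr mulr1 lerBlDr.
rewrite {1}eqB; under eq_bigr do rewrite fcoefD.
rewrite big_split /= lerD //.
  case: N => [|N]; first by rewrite big_geq.
  by rewrite big_nat_recl // big1 ?addr0.
rewrite (partial_sumM J B) mulrC (le_trans _ (ler_wpM2r _ (sumJ N))) //; last first.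
  by rewrite sumr_ge0 // => i _; exact: renewal_ge0.
rewrite mulr_suml; apply: ler_sum_nat => i /andP[_ iN]; rewrite ler_wpM2l //.
rewrite [leRHS](big_cat_nat (leq0n (N - i)) (leq_subr i N)) /= lerDl sumr_ge0 // => j _.
exact: renewal_ge0.
Qed.

Lemma renewal_summable : abs_summable (fcoef B).
Proof.
exists (1 - s)^-1 => n; under eq_bigr do rewrite ger0_norm ?renewal_ge0 //.
exact: renewal_sum_le.
Qed.

(* Strong induction on [n]: in the sum of [J_i B_(n-i)] the induction hypothesis
   is used for [i <= n/(p + 1)], where [psi n <= r^2 psi (n - i)] with
   [s r^2 < 1]; for the other [i] it is [J_i] that is of order [n^(-3/2)]. *)
Lemma renewal_psi_bound : exists M, forall n, psi R n * `|fcoef B n| <= M.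
Proof.
have [_ _ Jk] := asymJ; have [A tA] := cvgn_bounded Jk.
have A0 : 0 <= A by apply: le_trans (tA 0%N).
have JA n : psi R n * fcoef J n <= A.
  by apply: le_trans (tA n); exact: ler_norm.
(* This choice gives [s (1 + 3/p) < 1], while [r^2 = (1 + 1/p)^2 <= 1 + 3/p]. *)
pose p := (Num.bound (3 * s / (1 - s))).+1.
have p_gt0 : 0 < p%:R :> R by rewrite ltr0n.
pose r : R := 1 + p%:R^-1.
have r1 : 1 <= r by rewrite lerDl invr_ge0 ltW.
have r0 : 0 <= r by apply: le_trans r1.
have th1 : s * r ^+ 2 < 1.
  have hp : 3 * s / (1 - s) < p%:R.
    apply: lt_trans (archi_boundP _) _; last by rewrite ltr_nat.
    by rewrite divr_ge0 ?mulr_ge0 ?subr_ge0 // ltW.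
  have hp2 : s * (3 * p%:R^-1) < 1 - s.
    rewrite mulrA ltr_pdivrMr // mulrC; move: hp; rewrite ltr_pdivrMr ?subr_gt0 //; lra.
  have i1 : p%:R^-1 <= 1 :> R by rewrite invf_le1 // ler1n.
  have i0 : 0 <= p%:R^-1 :> R by rewrite invr_ge0 ltW.
  rewrite /r; move: (p%:R^-1) i1 i0 hp2 => x x1 x0 hx.
  have : s * (x * x) <= s * x by rewrite ler_wpM2l // ler_piMl.
  by rewrite expr2; nra.
pose c : R := p.+1%:R ^+ 2.
pose D := c * A * (1 - s)^-1.
have D0 : 0 <= D by rewrite !mulr_ge0 ?invr_ge0 ?subr_ge0 ?exprn_ge0 // ltW.
(* [M] is the fixed point of [M -> s r^2 M + D], the bound which the induction step returns. *)
pose M := D / (1 - s * r ^+ 2).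
have M0 : 0 <= M by rewrite divr_ge0 // subr_ge0 ltW.
have eM : r ^+ 2 * M * s + D = M.
  by rewrite /M; field; rewrite subr_eq0 gt_eqF.
exists M; elim/ltn_ind => n IHn; rewrite ger0_norm ?renewal_ge0 //.
case: n IHn => [|n] IHn; first by rewrite /psi !mul0r.
rewrite eqB fcoefD fcoef1 add0r fcoefM mulr_sumr.
apply: (@le_trans _ _
  (\sum_(i < n.+2) (r ^+ 2 * M * fcoef J i + c * A * fcoef B (n.+1 - i)))).
  apply: ler_sum => i _; have iN : (i <= n.+1)%N by rewrite -ltnS.
  have B0 := renewal_ge0 (n.+1 - i).
  have [ip|ip] := leqP (i * p.+1) n.+1.
    rewrite -[leLHS]addr0 lerD ?mulr_ge0 ?exprn_ge0 //.
    have [->|i0] := posnP i; first by rewrite J0 mul0r !mulr0.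
    have lt_i : (n.+1 - i < n.+1)%N by lia.
    have := IHn _ lt_i; rewrite ger0_norm // => IH.
    rewrite mulrCA mulrC ler_wpM2r //.
    have h : psi R n.+1 <= r ^+ 2 * psi R (n.+1 - i).
      apply: psi_scale => //; rewrite /r mulrDl mul1r.
      rewrite -[n.+1 in leLHS](subnK iN) natrD lerD2l ler_pdivlMl // -natrM ler_nat.
      by rewrite leq_subRL // -mulSn mulnC.
    apply: le_trans (ler_wpM2r B0 h) _; by rewrite -mulrA ler_wpM2l // exprn_ge0.
  have t0 : 0 <= r ^+ 2 * M * fcoef J i.
    by apply: mulr_ge0 => //; apply: mulr_ge0 => //; exact: exprn_ge0.
  rewrite -[leLHS]add0r; apply: lerD t0 _; rewrite mulrA ler_wpM2r //.
  have h : psi R n.+1 <= c * psi R i.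
    by apply: psi_scale; rewrite ?ler1n // -natrM ler_nat; lia.
  by apply: le_trans (ler_wpM2r (J_ge0 i) h) _; rewrite -mulrA ler_wpM2l ?exprn_ge0.
rewrite big_split /= -!mulr_sumr -[leRHS]eM lerD //.
  apply: ler_wpM2l; first by apply: mulr_ge0 => //; exact: exprn_ge0.
  by have := sumJ n.+2; rewrite big_mkord.
rewrite /D; apply: ler_wpM2l; first by apply: mulr_ge0 => //; exact: exprn_ge0.
have := renewal_sum_le n.+2; rewrite big_mkord (reindex_inj rev_ord_inj) /=.
by under eq_bigr do rewrite subSS.
Qed.

Let T := (1 - s)^-1.

Lemma renewal_sum : (fun n => \sum_(0 <= i < n) fcoef B i) @ \oo --> T.
Proof.
have [sJ Js _] := asymJ; have [_ h1 _] := asym1 R.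
have [U BU] := abs_summable_cvg renewal_summable.
have h := sum_cvgM sJ renewal_summable Js BU.
have eU : U = 1 + s * U.
  apply: (cvg_unique _ BU) => //; rewrite {1}eqB; apply: eq_cvgn (cvgnD h1 h) => n.
  by rewrite -big_split.
suff -> : T = U by [].
apply: (mulfI (_ : 1 - s != 0)); first by rewrite subr_eq0 gt_eqF.
by rewrite divff ?subr_eq0 ?gt_eqF // mulrBl mul1r {1}eU addrK.
Qed.

(* The weight [n] turns [1 / (1 - J)] into a Cauchy product of summable series,
   to which Tannery's theorem applies. *)
Lemma theta_renewal : theta B = theta J * (B * B).
Proof.
have h1 : (1 - J) * B = 1 by rewrite mulrBl mul1r {1}eqB addrK.
have h2 : theta B = theta J * B + J * theta B.
  rewrite {1}eqB -thetaM; apply: fpsP => n; rewrite /= mulrDr.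
  by case: n => [|n]; rewrite ?mul0r ?mulr0 ?add0r.
have h3 : (1 - J) * theta B = theta J * B by rewrite mulrBl mul1r {1}h2 addrK.
by rewrite mulrA -h3 mulrAC h1 mul1r.
Qed.

Lemma invn_cvg0 : (fun n => n%:R^-1 : R) @ \oo --> (0 : R).
Proof. by apply: cvgn_pred; exact: cvg_harmonic. Qed.

Lemma renewal_tail : (fun n => psi R n * fcoef B n) @ \oo --> T ^+ 2 * k.
Proof.
have [sJ Js Jk] := asymJ; have [A tA] := cvgn_bounded Jk.
have A0 : 0 <= A by apply: le_trans (tA 0%N).
have JA n : psi R n * fcoef J n <= A by apply: le_trans (tA n); exact: ler_norm.
pose w := B * B.
have sw : abs_summable (fcoef w) by apply: abs_summableM; exact: renewal_summable.
have wT : (fun n => \sum_(0 <= i < n) fcoef w i) @ \oo --> T ^+ 2.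
  by rewrite expr2; apply: sum_cvgM => //; (exact: renewal_summable || exact: renewal_sum).
have [W wW] :=
  psi_boundM renewal_summable renewal_summable renewal_psi_bound renewal_psi_bound.
have W0 : 0 <= W by apply: le_trans (wW 0%N); apply: mulr_ge0; rewrite ?psi_ge0.
have sqrt_psi n : Num.sqrt n%:R = psi R n * n%:R^-1.
  case: n => [|n]; first by rewrite sqrtr0 /psi !mul0r.
  by rewrite /psi mulrAC divff ?mul1r // pnatr_eq0.
(* Bounded index in [w]: [sqrt n * (n - i)] is equivalent to [psi n], so each term tends to
   [w_i k]. *)
have half1 : (fun n => \sum_(0 <= i < n.+1) (if (i.*2 <= n)%N then
    fcoef w i * (Num.sqrt n%:R * ((n - i)%:R * fcoef J (n - i))) else 0))
    @ \oo --> T ^+ 2 * k.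
  apply: (@tannery _ _ (fun i => 4 * A * fcoef w i) _ (fun i => fcoef w i * k)).
  - have [C wC] := sw; exists (4 * A * C) => n.
    under eq_bigr do rewrite normrM ger0_norm ?mulr_ge0 //.
    by rewrite -mulr_sumr ler_wpM2l ?mulr_ge0.
  - by move=> n.
  - move=> n i; case: ifP => [ni|_]; last by rewrite normr0.
    have Jn := J_ge0 (n - i).
    rewrite normrM mulrC [leRHS]normrM [`|4 * A|]ger0_norm ?mulr_ge0 // ler_wpM2r //.
    rewrite ger0_norm ?mulr_ge0 ?sqrtr_ge0 //.
    apply: (@le_trans _ _ (psi R n * fcoef J (n - i))).
      rewrite mulrA ler_wpM2r // /psi mulrC ler_wpM2r ?sqrtr_ge0 // ler_nat leq_subr //.
    have h : psi R n <= 4 * psi R (n - i) by apply: psi_double; lia.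
    by rewrite (le_trans (ler_wpM2r Jn h)) // -mulrA ler_wpM2l.
  - move=> i.
    have h1 := psi_cvg_sub i Jk.
    have h2 := cvgnB h1 (@cvgnMl _ _ i%:R _ (cvgnM h1 invn_cvg0)).
    have h3 := @cvgnMl _ _ (fcoef w i) _ h2; rewrite !mulr0 subr0 in h3.
    apply: cvg_trans h3; apply: near_eq_cvg; near=> n.
    have ni : (i.*2 <= n)%N by near: n; exists i.*2.
    rewrite ni; congr (_ * _); rewrite natrB; last by lia.
    have xyz : psi R n * n%:R^-1 * n%:R = psi R n by rewrite -sqrt_psi mulrC.
    rewrite sqrt_psi -{1}xyz; move: (psi R n) (n%:R : R) (n%:R^-1 : R) => x y z; ring.
  have h : (fun n => (\sum_(0 <= i < n) fcoef w i) * k) @ \oo --> T ^+ 2 * k.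
    by apply: cvgnM wT _; exact: cvg_cst.
  by apply: eq_cvgn (cvgnS h) => n; rewrite mulr_suml.
(* Bounded index in [J]: [w_(n-j)] is [O(n^(-3/2))] against a weight [sqrt n], so each term is
   [O(1/n)]. For the majorant, [j <= n] bounds [sqrt n * j] by [psi n]. *)
have half2 : (fun n => \sum_(0 <= j < n.+1) (if (j.*2 < n)%N then
    fcoef w (n - j) * (Num.sqrt n%:R * (j%:R * fcoef J j)) else 0)) @ \oo --> (0 : R).
  have w4 n j : (j.*2 < n)%N -> psi R n * `|fcoef w (n - j)| <= 4 * W.
    move=> jn; have h : psi R n <= 4 * psi R (n - j) by apply: psi_double; lia.
    by rewrite (le_trans (ler_wpM2r _ h)) // -mulrA ler_wpM2l.
  apply: (@tannery0 _ _ (fun j => 4 * W * fcoef J j)).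
  - have [C JC] := sJ; exists (4 * W * C) => n.
    under eq_bigr do rewrite normrM ger0_norm ?mulr_ge0 //.
    by rewrite -mulr_sumr ler_wpM2l ?mulr_ge0.
  - by move=> n.
  - move=> n j; case: ifP => [jn|_]; last by rewrite normr0.
    rewrite [leRHS]ger0_norm ?mulr_ge0 // normrM.
    rewrite [`|Num.sqrt _ * _|]ger0_norm ?mulr_ge0 ?sqrtr_ge0 //.
    rewrite !mulrA ler_wpM2r // (le_trans _ (w4 _ _ jn)) // -mulrA mulrC ler_wpM2r //.
    by rewrite /psi mulrC ler_wpM2r ?sqrtr_ge0 // ler_nat; lia.
  - move=> j; pose E := 4 * W * (j%:R * fcoef J j).
    have h : (fun n => E * n%:R^-1) @ \oo --> (0 : R).
      by have := @cvgnMl _ _ E _ invn_cvg0; rewrite mulr0; exact.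
    apply/cvgr0Pnorm_le => e e0; near=> n.
    apply: (@le_trans _ _ (E * n%:R^-1)); last first.
      by apply: le_trans (ler_norm _) _; near: n; exact: (cvgr0_norm_le _ h _ e0).
    have jJ : 0 <= j%:R * fcoef J j by rewrite mulr_ge0.
    have E0 : 0 <= E by rewrite /E; apply: mulr_ge0 => //; apply: mulr_ge0.
    case: ifP => [jn|_]; last by rewrite normr0 mulr_ge0 ?invr_ge0.
    rewrite normrM [`|Num.sqrt _ * _|]ger0_norm; last first.
      by apply: mulr_ge0 => //; exact: sqrtr_ge0.
    rewrite sqrt_psi.
    have := ler_wpM2r (mulr_ge0 jJ (_ : 0 <= n%:R^-1)) (w4 _ _ jn).
    rewrite invr_ge0 ler0n => /(_ isT).
    have -> : E * n%:R^-1 = 4 * W * (j%:R * fcoef J j * n%:R^-1) by rewrite /E; ring.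
    by apply: le_trans; rewrite le_eqVlt; apply/orP; left; apply/eqP; ring.
have h := cvgnD half1 half2; rewrite addr0 in h; apply: eq_cvgn h => n.
rewrite -(sum_halves (fun i j => fcoef w i * (Num.sqrt n%:R * (j%:R * fcoef J j)))).
have -> : psi R n * fcoef B n = Num.sqrt n%:R * fcoef (theta B) n.
  by rewrite -[fcoef (theta B) n]/(n%:R * fcoef B n) mulrA; congr (_ * _); exact: mulrC.
rewrite theta_renewal [theta J * _]mulrC fcoefM mulr_sumr; apply: eq_bigr => i _.
by rewrite -[fcoef (theta J) _]/((n - i)%:R * fcoef J (n - i)) mulrCA.
Unshelve. all: by end_near. Qed.

Lemma asym_renewal : asym B T (T ^+ 2 * k).
Proof.
split; [exact: renewal_summable | exact: renewal_sum | exact: renewal_tail].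
Qed.

End Renewal.

(** * The square root series *)

Section SquareRoot.
Variable R : realType.
Local Notation X := (fpsX R).

(* The coefficients of the square root of [1 - x]. *)
Definition wallis_coef n : R := - (2 / pi * wallis R n.*2 / (n.*2%:R - 1)).

Lemma wallis_coef0 : wallis_coef 0 = 1.
Proof.
have pi0 : pi != 0 :> R by rewrite gt_eqF ?pi_gt0.
rewrite /wallis_coef double0 wallis0 sub0r invrN1 mulrN1 opprK mulrA divfK //.
by rewrite divff // pnatr_eq0.
Qed.

Lemma wallis_coefS n : wallis_coef n.+1 = - (2 / pi * wallis R n.*2 / n.*2.+2%:R).
Proof.
have e : n.*2.+2%:R - 1 = n.*2.+1%:R :> R by rewrite -[n.*2.+2%:R]natr1 addrK.
rewrite /wallis_coef doubleS e wallisSS; congr (- _).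
have n1 : n.*2.+1%:R != 0 :> R by rewrite pnatr_eq0.
apply: (mulIf n1); rewrite divfK // -!mulrA; congr (_ * (_ * _)).
by rewrite mulrC -!mulrA mulrCA.
Qed.

(** Summation divides [(1 - x)^(1/2)] by [1 - x]; the right-hand side is the coefficient
    [binomial(2n, n) / 4^n] of [(1 - x)^(-1/2)]. *)
Lemma wallis_coef_sum n : \sum_(0 <= i < n.+1) wallis_coef i = 2 / pi * wallis R n.*2.
Proof.
elim: n => [|n IHn].
  rewrite big_nat1 wallis_coef0 double0 wallis0.
  by rewrite mulrA divfK ?divff ?pnatr_eq0 // gt_eqF ?pi_gt0.
rewrite big_nat_recr //= IHn wallis_coefS doubleS wallisSS.
have : n.*2.+2%:R != 0 :> R by rewrite pnatr_eq0.
rewrite -[n.*2.+2%:R]natr1; move: (n.*2.+1%:R : R) (2 / pi : R) (wallis R n.*2) => a c w a0.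
by field.
Qed.

Lemma wallis_coefS_le0 n : wallis_coef n.+1 <= 0.
Proof.
by rewrite wallis_coefS oppr_le0 !mulr_ge0 ?invr_ge0 ?pi_ge0 // wallis_ge0.
Qed.

Lemma wallis_coef_norm_sum n : \sum_(0 <= i < n) `|wallis_coef i.+1| <= 1.
Proof.
under eq_bigr do rewrite ler0_norm ?wallis_coefS_le0 //.
rewrite sumrN; have := wallis_coef_sum n; rewrite big_nat_recl // wallis_coef0 => h.
have : 0 <= 2 / pi * wallis R n.*2 by rewrite !mulr_ge0 ?invr_ge0 ?pi_ge0 // wallis_ge0.
by rewrite -h -[_ <= 1]subr_ge0 opprK.
Qed.

Lemma wallis_coef_norm n : `|wallis_coef n| <= 1.
Proof.
case: n => [|n]; first by rewrite wallis_coef0 normr1.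
apply: le_trans (wallis_coef_norm_sum n.+1); rewrite big_nat_recr //= lerDr sumr_ge0 //.
Qed.

Lemma wallis_coef_tail :
  (fun n => psi R n * wallis_coef n) @ \oo --> - (2 * Num.sqrt pi)^-1.
Proof.
have h := @wallis_cvg R.
have h2 : (fun n => n%:R / (n.*2%:R - 1) : R) @ \oo --> (2^-1 : R).
  have e n : n.+1%:R / (n.+1.*2%:R - 1) = 2^-1 + 2^-1 * n.*2.+1%:R^-1 :> R.
    rewrite doubleS -[n.*2.+2%:R]natr1 addrK.
    have : n.*2.+1%:R != 0 :> R by rewrite pnatr_eq0.
    have -> : n.+1%:R = (n.*2.+1%:R + 1) / 2 :> R.
      by rewrite natr1 -doubleS -muln2 natrM mulfK // pnatr_eq0.
    by move: (n.*2.+1%:R : R) => a a0; field.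
  apply: cvgn_pred; apply: (@eq_cvgn _ _ _ _ (fun n => esym (e n))).
  have h3 : (fun n => n.*2.+1%:R^-1 : R) @ \oo --> (0 : R).
    apply: squeeze_cvgr (cvg_cst 0) (@cvg_harmonic R); near=> n.
    by rewrite invr_ge0 ler0n /= lef_pV2 ?posrE // ler_nat ltnS -addnn leq_addr.
  have h4 : (fun _ : nat => 2^-1 : R) @ \oo --> (2^-1 : R) by exact: cvg_cst.
  by have := cvgnD h4 (@cvgnMl _ _ 2^-1 _ h3); rewrite mulr0 addr0.
have := @cvgnMl _ _ (- (2 / pi)) _ (cvgnM h2 h).
have -> : - (2 / pi) * (2^-1 * (Num.sqrt pi / 2)) = - (2 * Num.sqrt pi)^-1 :> R.
  rewrite -[pi in 2 / pi]sqr_sqrtr ?pi_ge0 //.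
  have : Num.sqrt pi != 0 :> R by rewrite gt_eqF // sqrtr_gt0 pi_gt0.
  by move: (Num.sqrt pi) => a a0; field.
apply: eq_cvgn => n; rewrite /wallis_coef /psi.
by move: (Num.sqrt n%:R) ((n.*2%:R - 1)^-1) (pi^-1 : R) => a b c; ring.
Unshelve. all: by end_near. Qed.

Variable g : fps R.
Hypotheses (g2 : g ^+ 2 = 1 - X *+ 4) (g0 : fcoef g 0 = 1).

(** Applying [theta] to [g^2 = 1 - 4z] gives the differential equation
    [(1 - 4z) theta g = - 2 z g]. *)
Lemma sqrt_rec n : n.+1%:R * fcoef g n.+1 = (4 * n%:R - 2) * fcoef g n.
Proof.
have two0 : (2 : fps R) != 0.
  apply/eqP => /(congr1 (fun f => fcoef f 0)); rewrite fcoefMn fcoef1 /= => /eqP.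
  by rewrite pnatr_eq0.
have h1 : g * theta g = - (X *+ 2).
  apply: (mulfI two0).
  have -> : 2 * (g * theta g) = theta (g ^+ 2) by rewrite expr2 thetaM; ring.
  rewrite g2 (_ : 2 * _ = - (X *+ 4)); last by ring.
  apply: fpsP => m; rewrite -[LHS]/(m%:R * (fcoef (1 : fps R) m - fcoef (X *+ 4) m)).
  rewrite -[RHS]/(- fcoef (X *+ 4) m) fcoefMn fcoef1 /= coefX.
  by case: m => [|[|m]] /=; ring.
have h2 : theta g - X * theta g *+ 4 = - (X * g *+ 2).
  transitivity ((1 - X *+ 4) * theta g); first by ring.
  by rewrite -g2 expr2 -mulrA h1; ring.
have := congr1 (fun f => fcoef f n.+1) h2.
rewrite fcoefB fcoefMn fcoefXMS -[fcoef (- _) _]/(- fcoef (X * g *+ 2) n.+1).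
rewrite fcoefMn fcoefXMS -[fcoef (theta g) n.+1]/(n.+1%:R * fcoef g n.+1).
rewrite -[fcoef (theta g) n]/(n%:R * fcoef g n).
move: (n.+1%:R * fcoef g n.+1) (fcoef g n) (n%:R : R) => a b c /eqP.
by rewrite subr_eq => /eqP ->; ring.
Qed.

Lemma sqrt_coefE n : fcoef g n = 4 ^+ n * wallis_coef n.
Proof.
elim: n => [|n IHn]; first by rewrite g0 wallis_coef0 mulr1.
have n0 : n.+1%:R != 0 :> R by rewrite pnatr_eq0.
apply: (mulfI n0); rewrite sqrt_rec IHn wallis_coefS exprS /wallis_coef.
have e1 : n.*2.+2%:R = 2 * n.+1%:R :> R by rewrite -doubleS -muln2 natrM mulrC.
have e2 : 4 * n%:R - 2 = 2 * (n.*2%:R - 1) :> R by rewrite -muln2 natrM; ring.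
have d0 : n.*2%:R - 1 != 0 :> R.
  rewrite subr_eq0 -[1]/(1%:R) eqr_nat; lia.
rewrite e1 e2.
move: (4 ^+ n) (2 / pi : R) (wallis R n.*2) (n.+1%:R : R) n0 (n.*2%:R - 1 : R) d0.
by move=> a b c d d0 e e0; field; rewrite d0.
Qed.

(** Explicit coefficients give summability and the limit; the sum is forced by [S^2 = 1 - 1]. *)
Lemma asym_sqrt_crit : asym (fscale 4^-1 g) 0 (- (2 * Num.sqrt pi)^-1).
Proof.
have coefE n : fcoef (fscale 4^-1 g) n = wallis_coef n.
  by rewrite /= sqrt_coefE mulrAC -exprMn divff ?pnatr_eq0 // expr1n mul1r.
have sg : abs_summable (fcoef (fscale 4^-1 g)).
  exists 2 => -[|n]; first by rewrite big_geq.
  rewrite big_nat_recl // coefE wallis_coef0 normr1 -[2]/(1 + 1) lerD2l.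
  by under eq_bigr do rewrite coefE; exact: wallis_coef_norm_sum.
have [S gS] := abs_summable_cvg sg.
have gk : asym (fscale 4^-1 g) S (- (2 * Num.sqrt pi)^-1).
  split=> //; apply: eq_cvgn wallis_coef_tail => n; by rewrite coefE.
suff S0 : S = 0 by rewrite S0 in gk.
have e : fscale 4^-1 g * fscale 4^-1 g = 1 - X.
  rewrite -fscaleM -expr2 g2; apply: fpsP => n.
  rewrite -[LHS]/((fcoef (1 : fps R) n - fcoef (X *+ 4) n) * 4^-1 ^+ n).
  rewrite fcoefB fcoefMn fcoef1 /= coefX.
  case: n => [|[|n]] /=; rewrite ?mul0rn ?subr0 ?mul0r ?expr0 ?mulr1 //.
  by rewrite expr1 !sub0r mulNr divff // pnatr_eq0.
have := asymM gk gk; rewrite e => h.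
have [h1 _] := asym_uniq h (asymB (asym1 R) (asymX R)).
by move/eqP: h1; rewrite subrr mulf_eq0 orbb => /eqP.
Qed.

(** The relation [S^2 = 1 - 4c] leaves a sign open; it is settled by partial sums that stay above
    [1 - |4c|]. *)
Lemma asym_sqrt (c : R) : `|4 * c| < 1 -> asym (fscale c g) (Num.sqrt (1 - 4 * c)) 0.
Proof.
move=> c1.
have coefE n : fcoef (fscale c g) n = wallis_coef n * (4 * c) ^+ n.
  by rewrite /= sqrt_coefE exprMn; ring.
have [S gS] : exists S, asym (fscale c g) S 0.
  apply: (@asym_expdecay _ _ 1 `|4 * c|); first by rewrite normr_ge0.
  by move=> n; rewrite coefE normrM normrX ler_wpM2r ?exprn_ge0 // wallis_coef_norm.
have e : fscale c g * fscale c g = 1 - fpsC (4 * c) * X.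
  rewrite -fscaleM -expr2 g2; apply: fpsP => n.
  rewrite -[LHS]/((fcoef (1 : fps R) n - fcoef (X *+ 4) n) * c ^+ n).
  rewrite fcoefB fcoefMn fcoef1 fcoefCM /= coefX.
  case: n => [|[|n]] /=; rewrite ?mul0rn ?subr0 ?mulr0 ?subr0 ?mul0r ?expr0 ?mulr1 //.
  by rewrite !sub0r mulNr.
have := asymM gS gS; rewrite e => h.
have [h1 _] := asym_uniq h (asymB (asym1 R) (asymM (asymC (4 * c)) (asymX R))).
have S0 : 0 <= S.
  have [_ gs _] := gS.
  have h0 : (fun _ : nat => 1 - `|4 * c|) @ \oo --> (1 - `|4 * c| : R) by exact: cvg_cst.
  apply: (@le_trans _ _ (1 - `|4 * c|)); first by rewrite subr_ge0 ltW.
  apply: (ler_cvg_to h0 (cvgnS gs)); apply: nearW => n.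
  rewrite big_nat_recl // coefE wallis_coef0 mulr1 lerD2l lerNl -sumrN.
  apply: (@le_trans _ _ (\sum_(0 <= i < n) `|4 * c| * `|wallis_coef i.+1|)).
    apply: ler_sum => i _; rewrite coefE; apply: le_trans (ler_norm _) _.
    rewrite normrN normrM mulrC normrX exprS ler_wpM2r // ler_piMr // exprn_ile1 //.
    exact: ltW.
  by rewrite -mulr_sumr -[leRHS]mulr1 ler_wpM2l // wallis_coef_norm_sum.
suff -> : Num.sqrt (1 - 4 * c) = S by [].
by rewrite -[RHS]ger0_norm // -sqrtr_sqr expr2 h1 mulr1.
Qed.

End SquareRoot.

(** * The asymptotic formula *)

Section Assembly.
Variable R : realType.
Local Notation X := (fpsX R).

Lemma fpsC_nat m : fpsC (m%:R : R) = m%:R.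
Proof. by rewrite /fpsC !rmorph_nat. Qed.

Lemma fpsCMn (a : R) m : fpsC (a *+ m) = fpsC a *+ m.
Proof. by rewrite /fpsC !rmorphMn. Qed.

Lemma fpsCM (a b : R) : fpsC (a * b) = fpsC a * fpsC b.
Proof. by rewrite /fpsC !rmorphM. Qed.

Lemma fscaleMn (c : R) (f : fps R) m : fscale c (f *+ m) = fscale c f *+ m.
Proof. by apply: fpsP => n; rewrite fcoefMn /= fcoefMn mulrnAl. Qed.

Lemma asym_eq (f : fps R) (S T k l : R) : asym f S k -> S = T -> k = l -> asym f T l.
Proof. by move=> h <- <-. Qed.

Variables K y B : fps R.
Hypotheses (eqK : K = 1 + X * K ^+ 2) (eqy : y = X * (1 + y + y ^+ 2) *+ 2)
  (eqB : B = 1 + y * (K ^+ 2 - 1) * B).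
Local Notation al := (sqrt_catalan K).
Local Notation be := (sqrt_motzkin y).
Local Notation scale6 := (fscale 6^-1).
Local Notation r := (Num.sqrt 3 : R).

Lemma fcoef_sqrt_catalan0 : fcoef al 0 = 1.
Proof. by rewrite /sqrt_catalan fcoefB fcoefMn fcoefXM0 mul0rn subr0. Qed.

Lemma fcoef_sqrt_motzkin0 : fcoef be 0 = 1.
Proof.
by rewrite /sqrt_motzkin !fcoefB !fcoefMn fcoefXM0 fcoef1 /= coefX !mul0rn !subr0.
Qed.

Lemma catalan_ge0 n : 0 <= fcoef K n.
Proof.
elim/ltn_ind: n => n IHn; rewrite eqK fcoefD fcoef1.
case: n IHn => [|n] IHn; first by rewrite fcoefXM0 addr0 ler01.
rewrite fcoefXMS add0r expr2 fcoefM sumr_ge0 // => i _.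
by rewrite mulr_ge0 ?IHn // ltnS ?leq_subr // -ltnS.
Qed.

Lemma motzkin_ge0 n : 0 <= fcoef y n.
Proof.
elim/ltn_ind: n => n IHn; rewrite eqy fcoefMn mulrn_wge0 //.
case: n IHn => [|n] IHn; first by rewrite fcoefXM0.
rewrite fcoefXMS !fcoefD fcoef1 !addr_ge0 ?IHn // expr2 fcoefM sumr_ge0 // => i _.
by rewrite mulr_ge0 ?IHn // ltnS ?leq_subr // -ltnS.
Qed.

(** The factors [1 - 6z] and [1 + 2z] are [1 - 4z] at [3z/2] and at [-z/2], so one square root
    series serves for both. The constant term [1] selects the sign. *)
Lemma sqrt_motzkinE : be = fscale (3 / 2) al * fscale (- 2^-1) al.
Proof.
set q := _ * _.
have al2 := sqrt_catalan2 eqK.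
have lin (c : R) : fscale c (1 - X *+ 4) = 1 - fpsC c * X *+ 4.
  by rewrite fscaleB fscale1 fscaleMn fscaleX.
have q2 : q ^+ 2 = be ^+ 2.
  rewrite (sqrt_motzkin2 eqy) /q exprMn !expr2 -!fscaleM -expr2 al2 !lin.
  have e1 : fpsC (3 / 2 : R) *+ 2 = 3.
    by rewrite -fpsCMn (_ : 3 / 2 *+ 2 = 3 :> R) ?fpsC_nat //; lra.
  have e2 : fpsC (- 2^-1 : R) *+ 2 = - 1.
    rewrite -fpsCMn (_ : - 2^-1 *+ 2 = - 1 :> R); last by lra.
    by rewrite /fpsC !rmorphN !rmorph1.
  transitivity ((1 - (fpsC (3 / 2 : R) *+ 2) * X *+ 2)
    * (1 - (fpsC (- 2^-1 : R) *+ 2) * X *+ 2)).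
    by ring.
  by rewrite e1 e2; ring.
have /eqP : (be - q) * (be + q) = 0 by rewrite -subr_sqr q2 subrr.
rewrite mulf_eq0 subr_eq0 => /orP[/eqP //|/eqP/(congr1 (fun f => fcoef f 0))].
rewrite fcoefD fcoef_sqrt_motzkin0 /q fcoefM big_ord1.
rewrite -[fcoef (fscale _ _) 0]/(fcoef al 0 * 1).
rewrite -[fcoef (fscale (- _) _) _]/(fcoef al 0 * 1) fcoef_sqrt_catalan0.
by rewrite !mulr1 -[1 + 1]/(2%:R) => /eqP; rewrite pnatr_eq0.
Qed.

Lemma sqr_sqrt3 : r ^+ 2 = 3. Proof. by rewrite sqr_sqrtr. Qed.

Lemma sqrt3_gt0 : 0 < r. Proof. by rewrite sqrtr_gt0. Qed.

(* [c] is the explicit cofactor that reduces an identity in [sqrt 3] to [ring]. *)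
Lemma eq_mod_sqrt3 (a b c : R) : a - b = c * (r ^+ 2 - 3) -> a = b.
Proof. by rewrite sqr_sqrt3 subrr mulr0; exact: subr0_eq. Qed.

(** The singularity of [K] is at [1/4], beyond [1/6], so [K] has no [n^(-3/2)] part at this
    scale. *)
Lemma asym_catalan : asym (scale6 K) (3 - r) 0.
Proof.
have alE : scale6 al = 1 - fpsC 3^-1 * (X * scale6 K).
  rewrite /sqrt_catalan fscaleB fscale1 fscaleMn fscaleM fscaleX -mulrnAl -mulrnAl -fpsCMn.
  by rewrite -mulrA; congr (1 - fpsC _ * _); lra.
have sqrtE : Num.sqrt (1 - 4 * 6^-1) = r / 3 :> R.
  rewrite (_ : 1 - 4 * 6^-1 = (r / 3) ^+ 2); last by rewrite expr_div_n sqr_sqrt3; lra.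
  by rewrite sqrtr_sqr ger0_norm // divr_ge0 // ltW // sqrt3_gt0.
have h := asym_sqrt (sqrt_catalan2 eqK) fcoef_sqrt_catalan0 (_ : `|4 * 6^-1| < 1).
rewrite sqrtE alE in h.
apply/asym_XM; have -> : X * scale6 K = fpsC 3 * (1 - (1 - fpsC 3^-1 * (X * scale6 K))).
  rewrite opprB addrC subrK mulrA -fpsCM mulfV ?pnatr_eq0 //.
  by rewrite /fpsC !rmorph1 mul1r.
apply: asym_eq (asymM (asymC 3) (asymB (asym1 R) (h _))) _ _; last by lra.
- by rewrite ger0_norm; lra.
- by field.
Qed.

Local Notation kappa := (r / (2 * Num.sqrt pi)).

Lemma asym_motzkin : asym (scale6 y) 1 kappa.
Proof.
(* The first factor is critical with value [0], the second is regular with value [sqrt(4/3)]; only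
   their product contributes to the limit. *)
have beE : scale6 be = fscale 4^-1 al * fscale (- 12^-1) al.
  rewrite sqrt_motzkinE fscaleM !fscale_fscale.
  by congr (fscale _ _ * fscale _ _); lra.
have sqrtE : Num.sqrt (1 - 4 * - 12^-1) = 2 * r / 3 :> R.
  rewrite (_ : 1 - 4 * - 12^-1 = (2 * r / 3) ^+ 2); last first.
    by rewrite expr_div_n exprMn sqr_sqrt3; lra.
  by rewrite sqrtr_sqr ger0_norm // divr_ge0 // mulr_ge0 // ltW // sqrt3_gt0.
have h1 := asym_sqrt_crit (sqrt_catalan2 eqK) fcoef_sqrt_catalan0.
have h2 := asym_sqrt (sqrt_catalan2 eqK) fcoef_sqrt_catalan0 (_ : `|4 * - 12^-1| < 1).
rewrite sqrtE in h2.
have beE' : scale6 be = 1 - fpsC 3^-1 * X - fpsC (2 / 3) * (X * scale6 y).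
  rewrite /sqrt_motzkin !fscaleB fscale1 !fscaleMn fscaleM fscaleX.
  rewrite -!mulrnAl -!fpsCMn -mulrA.
  by congr (1 - fpsC _ * _ - fpsC _ * _); lra.
apply/asym_XM; have -> : X * scale6 y = fpsC (3 / 2) * (1 - fpsC 3^-1 * X - scale6 be).
  rewrite beE' opprB addrC subrK mulrA -fpsCM (_ : 3 / 2 * (2 / 3) = 1); last by lra.
  by rewrite /fpsC rmorph1 mul1r.
rewrite beE.
have h3 := asymM h1 (h2 _); have h4 := asymM (asymC 3^-1) (asymX R).
apply: asym_eq (asymM (asymC (3 / 2)) (asymB (asymB (asym1 R) h4) (h3 _))) _ _.
- by rewrite normrM normrN !ger0_norm; lra.
- by field.
have : Num.sqrt pi != 0 :> R by rewrite gt_eqF // sqrtr_gt0 pi_gt0.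
by move: (Num.sqrt pi : R) r => a b a0; field.
Qed.

Lemma asym_renewal_series : asym (scale6 B) ((3 * r + 5) / 4) ((16 + 9 * r) / 8 * kappa).
Proof.
pose J := scale6 (y * (K ^+ 2 - 1)).
have eqBt : scale6 B = 1 + J * scale6 B by rewrite {1}eqB fscaleD fscale1 fscaleM.
have hJ : asym J (11 - 6 * r) ((11 - 6 * r) * kappa).
  rewrite /J fscaleM fscaleB fscale1 expr2 fscaleM.
  have asymK2 := asymB (asymM asym_catalan asym_catalan) (asym1 R).
  apply: asym_eq (asymM asym_motzkin asymK2) _ _.
    by apply: (@eq_mod_sqrt3 _ _ 1); ring.
  rewrite (_ : (3 - r) * (3 - r) - 1 = 11 - 6 * r); first by ring.
  by apply: (@eq_mod_sqrt3 _ _ 1); ring.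
have J_ge0 n : 0 <= fcoef J n.
  rewrite /= mulr_ge0 ?exprn_ge0 ?invr_ge0 //; apply: sumr_ge0 => i _.
  apply: mulr_ge0; first exact: motzkin_ge0.
  rewrite -[leRHS]/(fcoef (K ^+ 2 - 1) (n - i)) fcoefB fcoef1 expr2.
  case: (n - i)%N => [|m].
    by rewrite fcoefM big_ord1 eqK fcoefD fcoefXM0 fcoef1 addr0 mulr1 subrr.
  rewrite subr0 fcoefM sumr_ge0 // => j _; apply: mulr_ge0; exact: catalan_ge0.
have J0 : fcoef J 0 = 0.
  by rewrite /J /= big_ord1 eqy fcoefMn fcoefXM0 mul0rn !mul0r.
(* This is precisely the condition [11 - 6 r < 1] on the value of [J] at the singularity. *)
have r53 : 5 / 3 < r by have := sqr_sqrt3; have := sqrt3_gt0; move: r => x; nra.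
have s1 : 11 - 6 * r < 1 by lra.
apply: asym_eq (asym_renewal hJ J_ge0 J0 s1 eqBt) _ _.
  apply: (mulfI (_ : 1 - (11 - 6 * r) != 0)); first by rewrite subr_eq0 gt_eqF.
  rewrite mulfV ?subr_eq0 ?gt_eqF //.
  by apply: (@eq_mod_sqrt3 _ _ (- (18 / 4))); field.
have -> : (1 - (11 - 6 * r))^-1 = (3 * r + 5) / 4.
  apply: (mulfI (_ : 1 - (11 - 6 * r) != 0)); first by rewrite subr_eq0 gt_eqF.
  rewrite mulfV ?subr_eq0 ?gt_eqF //.
  by apply: (@eq_mod_sqrt3 _ _ (- (18 / 4))); field.
apply: (@eq_mod_sqrt3 _ _ (- (54 * r + 81) / 16 * kappa)).
by move: kappa => k; field.
Qed.

Lemma asym_c : exists S,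
  asym (scale6 (FPS (fun n => (c_ n)%:R))) S ((9 + 6 * r) / (8 * Num.sqrt pi)).
Proof.
have -> : FPS (fun n => (c_ n)%:R) = succession_solution K y B 0 0.
  by apply: fpsP => n; rewrite (fcoef_solution_c eqK eqy eqB).
rewrite /= expr1 fscaleB expr2 !fscaleM fscaleD fscale1.
have hK := asym_catalan; have hB := asym_renewal_series; have hy := asym_motzkin.
have h := asymB (asymM (asymM hK hB) (asymD (asym1 R) hy))
  (asymM (asymM hy (asymM hK hK)) hB).
eexists; apply: asym_eq h (erefl _) _.
transitivity ((6 + 3 * r) / 4 * kappa).
  apply: (@eq_mod_sqrt3 _ _ ((5 - 15 * r / 8) * kappa)).
  by move: kappa => k; field.
have p0 : Num.sqrt pi != 0 :> R by rewrite gt_eqF // sqrtr_gt0 pi_gt0.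
apply: (@eq_mod_sqrt3 _ _ (3 / (8 * Num.sqrt pi))).
by move: (Num.sqrt pi : R) p0 r => p p0 x; field.
Qed.

End Assembly.

Lemma c_asymptotics (R : realType) :
  (fun n => psi R n * ((c_ n)%:R / 6 ^+ n)) @ \oo -->
    (9 + 6 * Num.sqrt 3) / (8 * Num.sqrt pi).
Proof.
have [K eqK] := fps_catalan R; have [y eqy] := fps_motzkin R.
have [B eqB'] := fps_geometric ((1 + y + y ^+ 2) *+ 2 * (K ^+ 2 - 1)).
have eqB : B = 1 + y * (K ^+ 2 - 1) * B.
  by rewrite {1}eqB' [in y * _]eqy; congr (_ + _); ring.
have [S [_ _ h]] := asym_c eqK eqy eqB.
by apply: eq_cvgn h => n; rewrite /= exprVn.
Qed.

Lemma asymptotic_equivalence (R : realType) (a : nat -> R) (l : R) : 0 < l ->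
    (fun n => psi R n * (a n / 6 ^+ n)) @ \oo --> l ->
  (a : nat -> R^o) ~_\oo (fun n => l * 6 ^+ n * n%:R `^ (- (3 / 2)) : R^o).
Proof.
move=> l0 al; apply/eqaddoP => e e0.
have el0 : 0 < e * l by rewrite mulr_gt0.
have hnear : \forall n \near \oo, `|psi R n * (a n / 6 ^+ n) - l| <= e * l.
  move/cvgrPdist_le: al => /(_ _ el0); apply: filterS => n; by rewrite distrC.
near=> n.
have n0 : 0 < n%:R :> R by rewrite ltr0n; near: n; exists 1%N.
have powE : n%:R `^ (- (3 / 2)) = (psi R n)^-1.
  rewrite powRN (_ : 3 / 2 = 1 + 2^-1); last by field.
  by rewrite powRD ?(gt_eqF n0) ?implybT // powRr1 ?ltW // powR12_sqrt // ltW.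
have psi0 : 0 < psi R n by rewrite mulr_gt0 ?sqrtr_gt0.
have six0 : 0 < 6 ^+ n :> R by rewrite exprn_gt0.
have hn : `|psi R n * (a n / 6 ^+ n) - l| <= e * l.
  by near: n; exact: hnear.
rewrite -[(_ - _) n]/(a n - l * 6 ^+ n * n%:R `^ (- (3 / 2))) powE.
have q0 : 0 < 6 ^+ n / psi R n by rewrite divr_gt0.
have -> : a n - l * 6 ^+ n / psi R n = (6 ^+ n / psi R n) * (psi R n * (a n / 6 ^+ n) - l).
  by field; rewrite !gt_eqF.
have -> : l * 6 ^+ n / psi R n = (6 ^+ n / psi R n) * l by field; rewrite gt_eqF.
have q1 : 0 < 6 ^+ n / psi R n * l by rewrite mulr_gt0.
rewrite (ger0_norm (ltW q1)) normrM (ger0_norm (ltW q0)) [leRHS]mulrCA.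
by apply: ler_wpM2l => //; exact: ltW.
Unshelve. all: by end_near. Qed.

Theorem corollary1p4 (R : realType) :
  [/\ forall n : nat, d_ n = c_ n,
      gen_fun d_ = gen_fun c_,
      algebraic_degree (@laurent_of_ratfun rat) (gen_fun c_)%:F 4 &
      (fun n : nat => (d_ n)%:R : R^o) ~_\oo
      (fun n : nat => (9 + 6 * Num.sqrt 3) / (8 * Num.sqrt pi)
                      * 6 ^+ n * n%:R `^ (- (3 / 2)) : R^o)].
Proof.
have dc : d_ = c_ by apply/funext => n; exact: d_eq_c.
rewrite dc; split=> //; first exact: degree_gen_fun_c.
apply: (asymptotic_equivalence _ (@c_asymptotics R)).
by rewrite divr_gt0 ?mulr_gt0 ?sqrtr_gt0 ?pi_gt0 // addr_gt0 // mulr_gt0 // sqrtr_gt0.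
Qed.
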